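(* Let $r=r_n$ be any positive real number. Then, asymptotically almost surely, $a_t(\mathcal{G}(n,r)) = \Theta(f_n)$, where $$ f_n = \begin{cases} n & \text{if } r < 1,\\[2pt] \dfrac{n}{(r \lg r)^2} & \text{if } r \ge 1 \text{ and } r\lg r \le \sqrt{n},\\[6pt] 1 & \text{if } r \lg r > \sqrt{n}. \end{cases} $$
   Context: $\lg$ denotes the binary logarithm. Here $r=r_n$ may depend on $n$, and asymptotics are as $n\to\infty$. Total acquisition number: let $G$ be a finite graph in which each vertex initially has weight $1$. A total acquisition move transfers all the weight from a vertex $u$ onto a neighbouring vertex $v$, and is allowed provided that immediately prior to the move the weight on $v$ is at least the weight on $u$. An acquisition protocol is a maximal sequence of such moves (moves are made until none remains). The residual set of a protocol is the set of vertices with positive weight at its end. The total acquisition number $a_t(G)$ is the minimum possible size of a residual set over all acquisition protocols on $G$. Random geometric graph: $\mathcal{G}(n,r)$ is the graph whose $n$ vertices are points chosen independently and uniformly at random in the square $[0,\sqrt n]^2$, with two distinct vertices adjacent if and only if their Euclidean distance is at most $r$. An event holds asymptotically almost surely if its probability tends to $1$ as $n\to\infty$.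
   Formalization: As f_n is undefined at r=1 and far exceeds n≥a_t for r slightly above 1 (e.g. r=1+1/n), the theorem proves a_t=Θ(min(n,f_n)) for every positive r_n, and the stated a_t=Θ(f_n) whenever r_n eventually avoids [1,1+ε) for some ε>0. *)

(* Defs.v *)
From mathcomp Require Import all_boot all_order all_algebra.
From mathcomp Require Import all_classical all_reals all_analysis.

Set Implicit Arguments.
Unset Strict Implicit.
Unset Printing Implicit Defensive.
Import Order.TTheory GRing.Theory Num.Theory.
Import numFieldNormedType.Exports.

Section Acquisition.
Variables (V : finType) (e : rel V).
Implicit Types (w : {ffun V -> nat}) (m : V * V) (s : seq (V * V)).

Definition acq_init : {ffun V -> nat} := [ffun=> 1].

(* A move (u, v) requires positive weight on u: moving an absent weight is not
   a move, otherwise no sequence of moves would ever be maximal. *)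
Definition acq_allowed w m : bool :=
  [&& e m.1 m.2, 0 < w m.1 & w m.1 <= w m.2].

Definition acq_move w m : {ffun V -> nat} :=
  [ffun x => if x == m.1 then 0
             else if x == m.2 then w m.2 + w m.1 else w x].

Fixpoint acq_legal w s : bool :=
  if s is m :: s' then acq_allowed w m && acq_legal (acq_move w m) s'
  else true.

Definition acq_final w s : {ffun V -> nat} := foldl acq_move w s.

Definition acq_stuck w : bool := [forall m, ~~ acq_allowed w m].

Definition acq_protocol s : bool :=
  acq_legal acq_init s && acq_stuck (acq_final acq_init s).

Definition residual_set s : {set V} :=
  finset (fun v => 0 < acq_final acq_init s v).

Lemma acq_protocol_exists : exists s, acq_protocol s.
Proof.
suff H k w : #|[pred x | 0 < w x]| < k ->
    exists s, acq_legal w s && acq_stuck (acq_final w s).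
  exact: (H _ acq_init (leqnn _)).
elim: k w => [//|k IHk] w; rewrite ltnS => wk.
have [st|] := boolP (acq_stuck w); first by exists [::].
move=> /forallPn[m /negPn mw].
have [|s sP] := IHk (acq_move w m); last by exists (m :: s); rewrite /= mw.
apply: leq_trans wk; apply: proper_card; apply/properP.
have [_ w1 w2] := and3P mw; split.
  apply/fintype.subsetP => x; rewrite !inE ffunE.
  case: ifP => // _; case: ifP => // /eqP -> _; exact: leq_trans w2.
by exists m.1; rewrite !inE // ffunE eqxx.
Qed.

Definition residual_size (k : nat) : bool :=
  `[< exists2 s, acq_protocol s & #|residual_set s| = k >].

Lemma residual_size_exists : exists k, residual_size k.
Proof.
have [s sP] := acq_protocol_exists.
by exists #|residual_set s|; apply/asboolP; exists s.
Qed.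

Definition total_acquisition_number : nat := ex_minn residual_size_exists.

End Acquisition.

Local Open Scope classical_set_scope.
Local Open Scope ring_scope.

Section RandomGeometricGraph.
Variable R : realType.

Definition lg (x : R) : R := ln x / ln 2.

Definition euclid_dist (p q : R * R) : R :=
  Num.sqrt ((p.1 - q.1) ^+ 2 + (p.2 - q.2) ^+ 2).

Definition geometric_graph (n : nat) (r : R) (x : 'I_n -> R * R) : rel 'I_n :=
  fun i j => (i != j) && (euclid_dist (x i) (x j) <= r).

Definition square (n : nat) : set (R * R) :=
  `[0, Num.sqrt n%:R] `*` `[0, Num.sqrt n%:R].

Definition area : set (R * R) -> \bar R :=
  (lebesgue_measure \x lebesgue_measure)%E.

Definition uniform_in_square d (T : measurableType d) (P : probability T R)
    (n : nat) (X : {RV P >-> (R * R)%type}) : Prop :=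
  forall A : set (R * R), measurable A ->
    distribution P X A = (area (A `&` square n) / area (square n))%E.

Definition independent_RVs d (T : measurableType d) (P : probability T R)
    (n : nat) (X : 'I_n -> {RV P >-> (R * R)%type}) : Prop :=
  forall (J : {set 'I_n}) (A : 'I_n -> set (R * R)),
    (forall i, measurable (A i)) ->
    P [set w | forall i, i \in J -> A i (X i w)]
      = (\prod_(i in J) P (X i @^-1` A i))%E.

(* Extended-real valued because the middle formula reads n / 0 = +oo at r = 1.
   It exceeds n, the trivial upper bound on the acquisition number, when
   0 <= r * lg r < 1, and by an unbounded factor as r decreases to 1; there the
   order of magnitude is min (n, acq_order n r) = n. *)
Definition acq_order (n : nat) (r : R) : \bar R :=
  if r < 1 then n%:R%:E
  else if r * lg r <= Num.sqrt n%:R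
       then (n%:R%:E / ((r * lg r) ^+ 2)%:E)%E
       else 1%E.

(* The constants may depend on the whole sequence of models, but not on n. *)
Definition aas_Theta (d : nat -> measure_display)
    (T : forall n, measurableType (d n)) (P : forall n, probability (T n) R)
    (a : forall n, T n -> nat) (f : nat -> \bar R) : Prop :=
  exists c C : R, [/\ 0 < c, 0 < C &
    P n [set w | (c%:E * f n <= (a n w)%:R%:E <= C%:E * f n)%E]
      @[n --> \oo] --> 1%E].

End RandomGeometricGraph.

(* Main.v *)
(** Lower bound. A move at least doubles the weight that it transports, so a unit
    of weight that ends on a vertex of weight W has travelled at most r lg W.
    If W is about 2^k then at least 2^k points lie within 2kr of it. The number of
    pairs at distance at most 2kr is O(n (kr)^2), hence O(n (kr)^2 / 2^k) units of
    weight are of this kind, and these sum to less than n/2 over all k with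
    2^k much larger than (r lg r)^2. The other units need at least a constant times
    n / (r lg r)^2 residual vertices.

    Upper bound. Cut the square into cells of side about r/4 and group these into
    blocks of about (lg r)^2 cells, of which there are O(n / (r lg r)^2). To move
    a whole cell to the corner of its block along a path of k cells, arrange its
    points in a balanced binomial tree, the nodes of depth j < k being helpers
    taken from the j-th cell of the path. If k is a small enough multiple of lg r
    then O(r^(9/8)) helpers suffice, which is far less than the r^2/16 points of a
    typical cell, so if no cell of the block has an unusual number of points then
    all cells can be emptied in turn and the block leaves a single residual
    vertex. In the other blocks each cell is a clique and leaves at most one
    vertex.

    In both bounds the only random quantity is the number of pairs of points in a
    common cell of a grid. It is a sum of pairwise uncorrelated variables, and
    Chebyshev's inequality is enough. *)

Require Import Defs.
From mathcomp Require Import all_boot all_order all_algebra.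
From mathcomp Require Import zify ring lra.

Set Implicit Arguments.
Unset Strict Implicit.
Unset Printing Implicit Defensive.
Import Order.TTheory GRing.Theory Num.Theory.

(** * Acquisition protocols and mergeable sets *)

Section Acquisition.
Variables (V : finType) (e : rel V).
Implicit Types (w : {ffun V -> nat}) (s : seq (V * V)) (A B U F : {set V}).

Lemma acq_legal_cat w s1 s2 :
  acq_legal e w (s1 ++ s2) = acq_legal e w s1 && acq_legal e (acq_final w s1) s2.
Proof. by elim: s1 w => //= m s1 IH w; rewrite IH andbA. Qed.

Lemma acq_final_cat w s1 s2 :
  acq_final w (s1 ++ s2) = acq_final (acq_final w s1) s2.
Proof. exact: foldl_cat. Qed.

Lemma acq_move_support w m : acq_allowed e w m ->
  [set x | 0 < acq_move w m x] \proper [set x | 0 < w x].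
Proof.
move=> /and3P[_ w1 w2]; apply/properP; split.
  apply/subsetP => x; rewrite !inE ffunE.
  by case: ifP => // _; case: ifP => // /eqP -> _; exact: leq_trans w2.
by exists m.1; rewrite !inE // ffunE eqxx.
Qed.

Lemma acq_legal_extend w : exists s,
  [/\ acq_legal e w s, acq_stuck e (acq_final w s) &
      [set x | 0 < acq_final w s x] \subset [set x | 0 < w x]].
Proof.
suff H k w' : #|[set x | 0 < w' x]| < k -> exists s,
    [/\ acq_legal e w' s, acq_stuck e (acq_final w' s) &
      [set x | 0 < acq_final w' s x] \subset [set x | 0 < w' x]].
  exact: (H _ w (leqnn _)).
elim: k w' => [//|k IHk] w'; rewrite ltnS => wk.
have [st|] := boolP (acq_stuck e w'); first by exists [::].
move=> /forallPn[m /negPn mw].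
have mp := acq_move_support mw.
have [|s [s1 s2 s3]] := IHk (acq_move w' m).
  exact: leq_trans (proper_card mp) wk.
exists (m :: s); rewrite /= mw; split=> //.
exact: subset_trans s3 (proper_sub mp).
Qed.

(** Completing a legal sequence to a protocol gives positive weight to no new vertex, so an upper
    bound may come from any legal sequence, maximal or not. *)
Lemma total_acquisition_number_le s : acq_legal e (acq_init V) s ->
  total_acquisition_number e <= #|[set x | 0 < acq_final (acq_init V) s x]|.
Proof.
move=> sl; have [s' [l' st sub]] := acq_legal_extend (acq_final (acq_init V) s).
rewrite /total_acquisition_number; case: ex_minnP => k _ /(_ _) kmin.
apply: leq_trans (subset_leq_card sub); apply: kmin.
apply/boolp.asboolP; exists (s ++ s').
  by rewrite /acq_protocol acq_legal_cat acq_final_cat sl l'.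
by rewrite /residual_set acq_final_cat.
Qed.

Lemma total_acquisition_number_attained : exists2 s,
  acq_legal e (acq_init V) s &
  total_acquisition_number e = #|[set x | 0 < acq_final (acq_init V) s x]|.
Proof.
rewrite /total_acquisition_number; case: ex_minnP => k /boolp.asboolP[s sP <-] _.
by exists s => //; case/andP: sP.
Qed.

(** All weights start at 1, so the weight gathered on the root of a set is the cardinality of the
    set. Sizes and edges alone thus decide whether the last move is allowed. *)
Inductive mergeable : {set V} -> V -> Prop :=
| mergeable1 v : mergeable [set v] v
| mergeableU A B u v : mergeable A u -> mergeable B v -> [disjoint A & B] ->
    e v u -> #|B| <= #|A| -> mergeable (A :|: B) u.

Lemma mergeable_mem A u : mergeable A u -> u \in A.
Proof.
by elim=> [v|{}A B {}u v _ uA _ _ _ _ _]; rewrite inE ?uA.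
Qed.

Definition merged w A u : {ffun V -> nat} :=
  [ffun x => if x == u then #|A| else if x \in A then 0 else w x].

(** Only the weights on [A] have to be 1, and [merged] leaves those outside [A] alone. Hence
    sequences for disjoint sets can be run one after the other. *)
Lemma mergeable_legal A u w : mergeable A u -> (forall x, x \in A -> w x = 1) ->
  exists2 s, acq_legal e w s & acq_final w s = merged w A u.
Proof.
move=> mA; elim: mA w => [v w w1|{}A B {}u v mA IHA mB IHB dAB evu BA w w1].
  exists [::] => //=; apply/ffunP => x; rewrite ffunE !inE cards1.
  by case: eqP => // ->; rewrite w1 // inE.
have uA := mergeable_mem mA; have vB := mergeable_mem mB.
have nB x : x \in A -> x \notin B by move=> xA; rewrite (disjointFr dAB xA).
have nA x : x \in B -> x \notin A by move=> xA; rewrite (disjointFl dAB xA).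
have uv : u != v by apply/eqP => E; move: (nB _ uA); rewrite E vB.
have [x xA|s sl sE] := IHA w; first by rewrite w1 // inE xA.
have [x xB|s' sl' sE'] := IHB (merged w A u).
  rewrite ffunE (negbTE (nA x xB)) w1 ?inE ?xB ?orbT //.
  by case: eqP => // E; move: (nA _ xB); rewrite E uA.
have wu : merged (merged w A u) B v u = #|A|.
  by rewrite !ffunE (negbTE uv) eqxx (negbTE (nB _ uA)).
have wv : merged (merged w A u) B v v = #|B| by rewrite !ffunE eqxx.
exists (s ++ s' ++ [:: (v, u)]).
  rewrite !acq_legal_cat sl sE sl' sE' /= /acq_allowed /= evu wu wv BA !andbT.
  by apply/card_gt0P; exists v.
rewrite !acq_final_cat sE sE' /=; apply/ffunP => x.
rewrite [LHS]ffunE /= wu wv [RHS]ffunE !ffunE cardsU.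
move: dAB; rewrite -setI_eq0 => /eqP ->; rewrite cards0 subn0 inE.
have [->|xv] := eqVneq x v; first by rewrite eq_sym (negbTE uv) vB orbT.
have [//|xu] := eqVneq x u.
by case: (boolP (x \in A)); case: (boolP (x \in B)).
Qed.

Lemma total_acquisition_number_fibers (I : finType) (f : V -> I) (Q : {set I}) :
  (forall v, f v \in Q) ->
  (forall v, exists u, mergeable [set x | f x == f v] u) ->
  total_acquisition_number e <= #|Q|.
Proof.
move=> fQ fm.
(* The fibres are merged in turn along an enumeration of [I]. Fibres still to come carry only
   weights 1, and each processed one keeps at most one vertex. *)
suff [s sl [sup _]] : exists2 s, acq_legal e (acq_init V) s &
    #|[set x | (f x \in enum I) && (0 < acq_final (acq_init V) s x)]|
      <= count (mem Q) (enum I) /\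
    forall x, f x \notin enum I -> acq_final (acq_init V) s x = 1.
  apply: leq_trans (total_acquisition_number_le sl) _.
  have -> : #|Q| = count (mem Q) (enum I).
    by rewrite cardE {1}/enum_mem size_filter enumT.
  apply: leq_trans sup; apply: subset_leq_card; apply/subsetP => x.
  by rewrite !inE mem_enum.
elim: (enum I) (enum_uniq I) => [_|i l IH /= /andP[il lu]].
  exists [::] => //=; split; last by move=> x _; rewrite ffunE.
  by rewrite leqn0 cards_eq0; apply/eqP/setP => x; rewrite !inE.
have [s sl [sup s1]] := IH lu.
have [/existsP[v /eqP fv]|/existsPn nf] := boolP [exists v, f v == i]; last first.
  exists s => //; split=> [|x]; last by rewrite inE negb_or => /andP[_ /s1].
  apply: leq_trans (leq_trans sup (leq_addl _ _)); apply: subset_leq_card.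
  by apply/subsetP => x; rewrite !inE (negbTE (nf x)).
have [u mu] := fm v.
have [x|s' sl' sE'] := mergeable_legal (w := acq_final (acq_init V) s) mu.
  by rewrite inE fv => /eqP fx; apply: s1; rewrite fx.
exists (s ++ s'); first by rewrite acq_legal_cat sl.
rewrite acq_final_cat sE'; split=> [|x]; last first.
  rewrite inE negb_or => /andP[xi /s1 sx]; rewrite ffunE sx inE fv (negbTE xi).
  by case: eqP => // E; move: (mergeable_mem mu); rewrite inE -E fv (negbTE xi).
have iQ : i \in Q by rewrite -fv.
have ui : f u = i by move: (mergeable_mem mu); rewrite inE fv => /eqP.
rewrite /= iQ add1n; apply: leq_ltn_trans (leq_trans _ (ltnSn _)).
  apply: (subset_leq_card (B := u |: [set x | (f x \in l) && (0 < acq_final (acq_init V) s x)])).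
  apply/subsetP => x; rewrite !inE !ffunE fv inE.
  have [//|xu] := eqVneq x u; by have [//|xi /=] := eqVneq (f x) i.
rewrite cardsU1 ltnS; apply: leq_trans (leq_add (leq_b1 _) sup) _.
by rewrite add1n.
Qed.

End Acquisition.

(** * Merging a block of cells *)

(* The balanced tree on [m <= 2 ^ i] nodes is obtained by letting the root of the
   balanced tree on [uphalf m] nodes absorb that of the tree on [m./2] nodes;
   [helpers i m k] is the number of its nodes of depth less than [k]. *)
Fixpoint helpers i m k : nat :=
  match i, k with
  | _, 0 => 0
  | 0, _ => m
  | i'.+1, k'.+1 => helpers i' (uphalf m) k + helpers i' m./2 k'
  end.

Lemma helpers0r i m : helpers i m 0 = 0. Proof. by case: i. Qed.

Lemma helpers0m i k : helpers i 0 k = 0.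
Proof. by elim: i k => [|i IH] [|k] //=; rewrite !IH. Qed.

Lemma helpers_le i m k : helpers i m k <= m.
Proof.
elim: i m k => [|i IH] m [|k] //=.
have mE : m = uphalf m + m./2 by rewrite uphalf_half; lia.
by rewrite {3}mE leq_add.
Qed.

(** An additional node goes to exactly one of the two halves, the parity of [m] deciding which. *)
Lemma helpersS i m k : helpers i m k <= helpers i m.+1 k <= (helpers i m k).+1.
Proof.
elim: i m k => [|i IH] m [|k] //=; first by rewrite leqnn leqnSn.
have := IH (uphalf m) k.+1; have := IH m./2 k.
have := uphalf_half m.
have [mo|me] := boolP (odd m); rewrite ?add0n ?add1n => -> ; lia.
Qed.

(** In a binomial tree of order [i], giving the nodes of depth [j] the weight 3^(-j) makes a total
    of (4/3)^i, and nodes of depth below [k] weigh at least 3^(-k). In the induction this is 3^(k+1)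
    + 3^k = 4 * 3^k. *)
Lemma helpers_bound i m k : m <= 2 ^ i ->
  3 ^ i * helpers i m k <= 4 ^ i * 3 ^ k.
Proof.
elim: i m k => [|i IH] m [|k] //= mi; rewrite ?muln0 //.
  by rewrite !mul1n (leq_trans mi) // expn_gt0.
have := IH (uphalf m) k.+1; have := IH m./2 k.
rewrite expnS in mi.
have h1 : m./2 <= 2 ^ i by lia.
have h2 : uphalf m <= 2 ^ i by rewrite uphalf_half; lia.
move=> /(_ h1) {}h1 /(_ h2) {}h2.
rewrite (expnS 3 i) (expnS 4 i) (expnS 3 k) in h2 *; nia.
Qed.

(** Squaring turns 4/3 into 16/9, which is below 2, so the bound becomes a power of two. *)
Lemma helpers_sqr i m k : m <= 2 ^ i -> helpers i m k ^ 2 <= 2 ^ (i + 4 * k).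
Proof.
move=> /(helpers_bound k) h.
have h2 : 9 ^ i * helpers i m k ^ 2 <= 16 ^ i * 9 ^ k.
  rewrite (_ : 9 = 3 ^ 2) // (_ : 16 = 4 ^ 2) // -!expnM ![2 * _]mulnC !expnM.
  by rewrite -!expnMn leq_exp2r.
have e p q j : p <= q -> p ^ j <= q ^ j.
  by move=> pq; case: j => // j; rewrite leq_exp2r.
rewrite -(leq_pmul2l (m := 8 ^ i)) ?expn_gt0 //.
apply: leq_trans (leq_mul (e 8 9 i isT) (leqnn _)) (leq_trans h2 _).
rewrite (_ : 16 = 8 * 2) // expnMn -mulnA leq_pmul2l ?expn_gt0 // expnD expnM.
by rewrite leq_pmul2l ?expn_gt0 // e.
Qed.

(* Growing the tree by one node adds either one helper or one target node. *)
Lemma helpers_exact i k N : N + helpers i (2 ^ i) k <= 2 ^ i ->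
  exists2 m, m <= 2 ^ i & m - helpers i m k = N.
Proof.
move=> Ni.
have ex : exists m, N <= m - helpers i m k by exists (2 ^ i); lia.
have Q m : N <= m - helpers i m k -> m - helpers i m k = N \/
   exists2 m', m' < m & N <= m' - helpers i m' k.
  case: m => [|m]; first by rewrite sub0n leqn0 => /eqP ->; left.
  move=> h; have := helpersS i m k; have := helpers_le i m k => h1 h2.
  have [/eqP|ne] := boolP (m.+1 - helpers i m.+1 k == N); first by left.
  by right; exists m => //; move/eqP: ne; lia.
have [m mN mmin] := ex_minnP ex.
exists m; first by apply: mmin; lia.
by have [//|[m' m'm /mmin]] := Q _ mN; rewrite leqNgt m'm.
Qed.

(** * Trees along paths of cells *)

Section Block.
Variables (V : finType) (e : rel V) (C : finType) (pos : V -> C).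
Variables (par : C -> C) (lev : C -> nat) (root : C).
Hypothesis adj_same : forall u v, u != v -> pos u = pos v -> e u v.
Hypothesis adj_par : forall u v, u != v -> pos u = par (pos v) -> e v u.
Hypothesis lev_par : forall c, lev (par c) = (lev c).-1.
Implicit Types (A B U F : {set V}) (c : C).

Definition cell c := [set v | pos v == c].

Lemma mergeable_union c A B : [disjoint A & B] ->
  (exists2 u, pos u = c & mergeable e A u) ->
  (exists2 u, pos u = c & mergeable e B u) ->
  exists2 u, pos u = c & mergeable e (A :|: B) u.
Proof.
move=> dAB [u uc mA] [v vc mB].
have uv : u != v.
  apply/eqP => uv; move: (mergeable_mem mB); rewrite -uv.
  by rewrite (disjointFr dAB (mergeable_mem mA)).
have [AB|/ltnW BA] := leqP #|A| #|B|.
  exists v => //; rewrite setUC; apply: mergeableU mB mA _ _ AB.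
    by rewrite disjoint_sym.
  by apply: adj_same => //; rewrite uc vc.
exists u => //; apply: mergeableU mA mB dAB _ BA.
by apply: adj_same; rewrite 1?eq_sym // uc vc.
Qed.

Lemma mergeable_clique c A : A != set0 -> A \subset cell c ->
  exists2 u, pos u = c & mergeable e A u.
Proof.
have [k] := ubnP #|A|; elim: k A => // k IH A /ltnSE Ak /set0Pn[u uA] Ac.
have uc : pos u = c by move/subsetP: Ac => /(_ _ uA); rewrite inE => /eqP.
have s1 : exists2 u', pos u' = c & mergeable e [set u] u'.
  by exists u => //; exact: mergeable1.
rewrite -(setD1K uA).
have [->|An] := eqVneq (A :\ u) set0; first by rewrite setU0.
apply: mergeable_union => //; first by rewrite disjoints1 !inE eqxx.
apply: IH => //; first by rewrite (cardsD1 u) uA in Ak.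
by apply: subset_trans Ac; exact: subD1set.
Qed.

Let anc c k := iter k par c.

Lemma lev_anc c k : lev (anc c k) = lev c - k.
Proof. by elim: k => [|k IH] /=; rewrite ?subn0 // lev_par IH subnS. Qed.

(** The root lies in the [k]-th ancestor of [t], a node of depth [j <= k] in the ancestor [k - j],
    and all deeper nodes in [t]; every tree edge then stays in a cell or leads to its parent. The
    helpers are the nodes outside [t]. Each ancestor cell is asked to have room for all of them,
    which spares a count cell by cell. *)
Lemma balanced_tree t i m k F : 0 < m <= 2 ^ i -> k <= lev t ->
  m - helpers i m k <= #|F :&: cell t| ->
  (forall j, 0 < j <= k -> helpers i m k <= #|F :&: cell (anc t j)|) ->
  exists U u, [/\ U \subset F, pos u = anc t k, mergeable e U u, #|U| = m &
     #|U :&: cell t| = m - helpers i m k].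
Proof.
have base F' k' c : c = anc t k' -> k' <= lev t -> 0 < #|F' :&: cell c| ->
    exists U u, [/\ U \subset F', pos u = c, mergeable e U u, #|U| = 1 &
     #|U :&: cell t| = (k' == 0)].
  move=> -> kt /card_gt0P[u]; rewrite !inE => /andP[uF /eqP uc].
  exists [set u], u; split; rewrite ?sub1set ?cards1 //; first exact: mergeable1.
  have [k0|kn] := posnP k'.
    by rewrite (setIidPl _) ?cards1 // sub1set inE uc k0 /= eqxx.
  apply/eqP; rewrite cards_eq0; apply/eqP/setP => x; rewrite !inE.
  case: eqP => //= ->; rewrite uc; apply/eqP => /(congr1 lev).
  by rewrite lev_anc; lia.
elim: i m k F => [|i IH] m k F.
  rewrite expn0 -eqn_leq => /eqP <- kt; case: k kt => [|k] kt /= h1 h2.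
    by have [U [u ?]] := base F 0 t erefl isT h1; exists U, u.
  by have [U [u ?]] := base F k.+1 _ erefl kt (h2 k.+1 (leqnn _)); exists U, u.
rewrite expnS => /andP[m0 mi] kt.
(* For [m = 1] the lower half would be empty and have no root, so only [i] decreases. *)
have [m1|m1] : m = 1 \/ 1 < m by lia.
  subst m; have -> : helpers i.+1 1 k = helpers i 1 k.
    by case: k {kt} => [|k] /=; rewrite ?helpers0m ?addn0 // helpers0r.
  by move=> h1 h2; apply: IH; rewrite // expn_gt0.
have ml1 : uphalf m <= 2 ^ i by rewrite uphalf_half; lia.
have ml2 : m./2 <= 2 ^ i by lia.
have mp1 : 0 < uphalf m by rewrite uphalf_half; lia.
have mp2 : 0 < m./2 by lia.
have mE : m = uphalf m + m./2 by rewrite uphalf_half; lia.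
set h := helpers i.+1 m k; set a := helpers i (uphalf m) k.
pose b := helpers i m./2 k.-1.
have hE : h = a + b.
  by rewrite /h /a /b; case: k {kt h a b} => //=; rewrite !helpers0r.
have am : a <= uphalf m by exact: helpers_le.
have bm : b <= m./2 by exact: helpers_le.
move=> h1 h2.
have [||j /h2|U1 [u1 [UF1 p1 mU1 cU1 tU1]]] :=
  IH (uphalf m) k F _ kt; rewrite ?mp1 ?ml1 -/a //; try lia.
have cD c : #|F :&: cell c| = #|U1 :&: cell c| + #|(F :\: U1) :&: cell c|.
  rewrite -(cardsID U1 (F :&: cell c)); congr (_ + _); apply: eq_card => x.
    rewrite !inE; case: (boolP (x \in U1)) => //= xU; rewrite ?andbF ?andbT //.
    by rewrite (subsetP UF1).
  by rewrite !inE andbA.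
(* [U1] has only [a] vertices outside [t], and the levels show that these ancestors of [t] differ
   from [t]. *)
have U1c j : 0 < j <= k -> #|U1 :&: cell (anc t j)| <= a.
  move=> jk; have tD := cardsID (cell t) U1.
  apply: (@leq_trans #|U1 :\: cell t|); last by lia.
  apply: subset_leq_card; apply/subsetP => x.
  rewrite !inE => /andP[-> /eqP ->]; rewrite andbT.
  by apply/eqP => /(congr1 lev); rewrite lev_anc; lia.
have [|||j jk|U2 [u2 [UF2 p2 mU2 cU2 tU2]]] := IH m./2 k.-1 (F :\: U1).
- by rewrite mp2.
- by lia.
- by rewrite -/b; move: (cD t); rewrite tU1; lia.
- have jk' : 0 < j <= k by lia.
  by rewrite -/b; have := cD (anc t j); have := U1c _ jk'; have := h2 _ jk'; lia.
have d12 : [disjoint U1 & U2].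
  rewrite -setI_eq0; apply/eqP/setP => x; rewrite !inE; apply/andP => -[xU1].
  by move/(subsetP UF2); rewrite inE xU1.
exists (U1 :|: U2), u1; split=> //.
- by rewrite subUset UF1 (subset_trans UF2) ?subsetDl.
- apply: (mergeableU mU1 mU2 d12).
    have u12 : u1 != u2.
      apply/eqP => E; move: (mergeable_mem mU2); rewrite -E.
      by rewrite (disjointFr d12 (mergeable_mem mU1)).
    move: p1 p2; case: k {kt h a hE am h1 h2 U1c tU1 b bm tU2} => [|k] /= p1 p2.
      by apply: adj_same; rewrite 1?eq_sym // p1.
    by apply: adj_par; rewrite // p1 p2.
  by rewrite cU1 cU2 uphalf_half; lia.
- by rewrite cardsU (eqP (_ : U1 :&: U2 == set0)) ?setI_eq0 // cards0 cU1 cU2; lia.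
- rewrite setIUl cardsU tU1 tU2 -setIIl (eqP (_ : U1 :&: U2 == set0)) ?setI_eq0 //.
  by rewrite set0I cards0; lia.
Qed.

(* Emptying the cells by decreasing level keeps the helper cells, which lie on
   lower levels, in use. *)
Lemma mergeable_block i h (Q : {set C}) F : F != set0 ->
  (forall v, v \in F -> pos v \in Q) -> (forall c, c \in Q -> par c \in Q) ->
  (forall c, c \in Q -> lev c = 0 -> c = root) ->
  (forall c m, c \in Q -> m <= 2 ^ i -> helpers i m (lev c) < h) ->
  (forall c, c \in Q -> #|Q| * h <= #|F :&: cell c| <= 2 ^ i - h) ->
  exists2 u, pos u = root & mergeable e F u.
Proof.
have [k] := ubnP #|Q|; elim: k Q F => // k IH Q F /ltnSE Qk Fn FQ parQ lev0 hh Qc.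
have [v0 v0F] := set0Pn _ Fn.
have [t tQ tmax] := arg_maxnP lev (FQ _ v0F).
have {}tQ : t \in Q := tQ.
have Q0 : 0 < #|Q| by apply/card_gt0P; exists t.
have h0 : 0 < h by apply: leq_ltn_trans (hh t 0 tQ _).
have /andP[Nl Nu] := Qc _ tQ.
have ht := hh _ _ tQ (leqnn _).
(* The size [m] is such that the tree takes exactly the remaining vertices of [t]. The margin [h]
   below [2 ^ i] leaves room for the helpers. *)
have [|m mi mN] := @helpers_exact i (lev t) #|F :&: cell t|; first by lia.
have hm := hh _ _ tQ mi.
have N0 : 0 < #|F :&: cell t| by apply: leq_trans Nl; rewrite muln_gt0 Q0.
have ancQ j : anc t j \in Q by elim: j => //= j; exact: parQ.
have [|||j jt|U [u [UF uroot mU cU tU]]] := @balanced_tree t i m (lev t) F.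
- by lia.
- by [].
- by rewrite mN.
- have /andP[+ _] := Qc _ (ancQ j); apply: leq_trans.
  by apply: leq_trans (ltnW hm) _; rewrite leq_pmull.
have Ut : U :&: cell t = F :&: cell t.
  by apply/eqP; rewrite eqEcard setSI // tU mN leqnn.
have {}uroot : pos u = root.
  by rewrite uroot; apply: lev0; [exact: ancQ|rewrite lev_anc subnn].
have [FU|FUn] := eqVneq (F :\: U) set0.
  have -> : F = U by apply/eqP; rewrite eqEsubset UF -setD_eq0 FU eqxx.
  by exists u.
have -> : F = U :|: (F :\: U).
  by apply/setP => x; rewrite !inE; case: (boolP (x \in U)) => // /(subsetP UF).
apply: mergeable_union; [|by exists u|].
  by rewrite -setI_eq0; apply/eqP/setP => x; rewrite !inE; case: (x \in U).
have cQ : #|Q| = (#|Q :\ t|).+1 by rewrite (cardsD1 t) tQ.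
apply: (IH (Q :\ t)) => //.
- by rewrite -ltnS -cQ.
- move=> v; rewrite !inE => /andP[vU vF]; rewrite (FQ _ vF) andbT.
  by apply/eqP => vt; move/setP/(_ v): Ut; rewrite !inE vt eqxx (negbTE vU) vF.
- move=> c; rewrite !inE => /andP[ct cQ']; rewrite (parQ _ cQ') andbT.
  (* The emptied cell is not the parent of a remaining one: by maximality of its level both would
     have level 0, so both would be the root. *)
  apply/eqP => pt; have := tmax _ cQ'; rewrite -pt lev_par => cl.
  case/eqP: ct; rewrite -pt.
  by rewrite [RHS]lev0 ?lev_par ?[LHS]lev0 ?parQ // ?lev_par; lia.
- by move=> c; rewrite inE => /andP[_]; exact: lev0.
- by move=> c m'; rewrite inE => /andP[_]; exact: hh.
move=> c; rewrite inE => /andP[ct cQ'].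
have /andP[cl cu] := Qc _ cQ'.
(* Any other cell loses fewer than [h] vertices, and the bound [#|Q| * h] drops by [h] because [Q]
   loses a cell. *)
have FUc : #|F :&: cell c| <= #|(F :\: U) :&: cell c| + #|U :\: cell t|.
  apply: leq_trans (leq_card_setU _ _); apply: subset_leq_card.
  apply/subsetP => x; rewrite !inE => /andP[xF /eqP xc]; rewrite xc eqxx xF.
  by move: ct; rewrite inE => ->; case: (x \in U).
have FU : #|(F :\: U) :&: cell c| <= #|F :&: cell c|.
  by apply: subset_leq_card; rewrite setSI // subsetDl.
have := cardsID (cell t) U; rewrite cU tU cQ in cl *.
by have := helpers_le i m (lev t); lia.
Qed.

End Block.

(** * The lower bound from pairs of close vertices *)

(** From 5 on, [2 * k.+1 ^ 2 <= 3 * k ^ 2], so the terms k^2 / 2^k decrease by a factor of at most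
    3/4 and the tail is at most four times its first term. *)
Lemma geometric_tail (x : nat -> nat) A k0 K : 5 <= k0 -> k0 <= K ->
  (forall k, k0 <= k < K -> 2 ^ k * x k <= A * k ^ 2) ->
  2 ^ k0 * \sum_(k0 <= k < K) x k <= 4 * (A * k0 ^ 2).
Proof.
move=> k5 /subnK; move: (K - k0) => j; elim: j k0 k5 => [|j IH] k0 k5.
  by move=> <-; rewrite add0n big_geq // muln0.
move=> jK xA; have kK : k0 < K by lia.
rewrite big_ltn //.
have := xA k0; rewrite leqnn kK => /(_ isT) h1.
have := IH k0.+1 _ _ _; rewrite addnS -addSn jK leqW // => /(_ isT erefl) {}IH.
have {IH} : 2 ^ k0.+1 * \sum_(k0.+1 <= k < K) x k <= 4 * (A * k0.+1 ^ 2).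
  by apply: IH => k /andP[k1 k2]; apply: xA; rewrite k2 ltnW.
rewrite expnS.
set S := \sum_(_ <= _ < _) _; move: (2 ^ k0) h1 => p h1 h2.
have : 2 * (A * k0.+1 ^ 2) <= 3 * (A * k0 ^ 2).
  by rewrite mulnCA [leqRHS]mulnCA leq_mul2l; apply/orP; right; nia.
nia.
Qed.

Section LowerBound.
Variables (R : realFieldType) (V : finType) (e : rel V).
Variables (dist : V -> V -> R) (rho : R).
Local Open Scope ring_scope.
Hypothesis rho0 : 0 <= rho.
Hypothesis e_irr : irreflexive e.
Hypothesis e_dist : forall u v, e u v -> dist u v <= rho.
Hypothesis dist0 : forall u, dist u u = 0.
Hypothesis distC : forall u v, dist u v = dist v u.
Hypothesis distD : forall u v w, dist u w <= dist u v + dist v w.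
Local Close Scope ring_scope.

Definition near_pairs (x : R) := #|[set p : V * V | (dist p.1 p.2 <= x)%R]|.

(** [D u] is the vertex that holds the unit of weight that started on [u], and [k] counts the moves
    of that unit. The pile that it joins is at least as heavy as its own, so each move at least
    doubles the weight around it. *)
Lemma acq_destination s : acq_legal e (acq_init V) s ->
  exists D : V -> V,
  (forall v, acq_final (acq_init V) s v = #|[set u | D u == v]|) /\
  (forall u, exists2 k, 2 ^ k <= acq_final (acq_init V) s (D u) &
                       (dist u (D u) <= k%:R * rho)%R).
Proof.
(* The induction needs arbitrary current weights [w], together with the destinations [D] reached so
   far. *)
suff H (w : {ffun V -> nat}) D : (forall v, w v = #|[set u | D u == v]|) ->
    (forall u, exists2 k, 2 ^ k <= w (D u) & (dist u (D u) <= k%:R * rho)%R) ->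
    acq_legal e w s -> exists D : V -> V,
  (forall v, acq_final w s v = #|[set u | D u == v]|) /\
  (forall u, exists2 k, 2 ^ k <= acq_final w s (D u) &
                       (dist u (D u) <= k%:R * rho)%R).
  apply: (H _ id) => v; last by exists 0; rewrite ?ffunE // dist0 mul0r.
  by rewrite ffunE -(cards1 v); apply: eq_card => u; rewrite !inE.
elim: s w D => [|[a b] s IH] w D wD wd /=; first by exists D.
move=> /andP[/and3P[/= eab wa wab]]; have ab : a != b.
  by apply/eqP => ab; move: eab; rewrite ab e_irr.
apply: (IH _ (fun u => if D u == a then b else D u)) => [v|u]; rewrite ffunE /=.
  have [->|va] := eqVneq v a.
    apply/esym/eqP; rewrite cards_eq0; apply/eqP/setP => u; rewrite !inE.
    by have [_|/negbTE] := eqVneq (D u) a; rewrite 1?eq_sym // (negbTE ab).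
  have [->|vb] := eqVneq v b; last first.
    rewrite wD; apply: eq_card => u; rewrite !inE.
    have [->|//] := eqVneq (D u) a; by rewrite eq_sym (negbTE va) eq_sym (negbTE vb).
  rewrite !wD -cardsUI [X in _ + X](_ : _ = 0) ?addn0; last first.
    apply/eqP; rewrite cards_eq0; apply/eqP/setP => u; rewrite !inE.
    by case: eqP => // ->; rewrite eq_sym (negbTE ab).
  apply: eq_card => u; rewrite !inE orbC; have [_|//] := eqVneq (D u) a.
  by rewrite eqxx.
have [k kw kd] := wd u.
have [Da|Da] := eqVneq (D u) a; rewrite ?(negbTE Da).
  rewrite eq_sym (negbTE ab) eqxx; exists k.+1.
    by rewrite expnS mul2n -addnn leq_add // -?Da // (leq_trans kw) ?Da.
  rewrite -addn1 natrD mulrDl mul1r; apply: le_trans (distD _ a _) _.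
  by rewrite lerD // ?e_dist // -?Da.
exists k => //; case: eqP => // Db; apply: leq_trans kw _.
by rewrite Db leq_addr.
Qed.

Lemma total_acquisition_number_ge k0 A : 5 <= k0 ->
  (forall k, k0 <= k -> 2 ^ k <= #|V| ->
     near_pairs ((2 * k)%:R * rho) <= A * k ^ 2) ->
  8 * (A * k0 ^ 2) <= 2 ^ k0 * #|V| ->
  #|V| <= 2 * (2 ^ k0 * total_acquisition_number e).
Proof.
move=> k5 kA k0A; have [s sl ->] := total_acquisition_number_attained e.
have [D [wD wd]] := acq_destination sl; set w := acq_final _ s in wD wd *.
pose lev u := trunc_log 2 (w (D u)).
have w0 u : 0 < w (D u) by rewrite wD; apply/card_gt0P; exists u; rewrite inE.
have levd u : (dist u (D u) <= (lev u)%:R * rho)%R.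
  have [k kw kd] := wd u; apply: le_trans kd _; apply: ler_wpM2r => //.
  by rewrite ler_nat; apply: trunc_log_max.
pose L k := [set u | lev u == k].
(* A unit [u] of level [k] shares its pile with at least [2 ^ k] units [v]. They have level [k] too,
   so the way through the common destination gives [dist u v] at most [2 * k * rho]. *)
have Lk k : k0 <= k < #|V| -> 2 ^ k * #|L k| <= A * k ^ 2.
  move=> /andP[k0k kn]; have [->|/set0Pn[u uL]] := eqVneq (L k) set0.
    by rewrite cards0 muln0.
  have kV : 2 ^ k <= #|V|.
    move: uL; rewrite inE => /eqP <-; apply: leq_trans (trunc_logP _ _) _ => //.
    by rewrite wD; exact: max_card.
  apply: leq_trans (kA _ k0k kV).
  have -> : 2 ^ k * #|L k| = \sum_(u in L k) 2 ^ k by rewrite sum_nat_const mulnC.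
  have -> : near_pairs ((2 * k)%:R * rho) =
      \sum_u #|[set v | (dist u v <= (2 * k)%:R * rho)%R]|.
    transitivity (\sum_u \sum_v (dist u v <= (2 * k)%:R * rho)%R : nat).
      rewrite pair_bigA /near_pairs -sum1_card big_mkcond; apply: eq_bigr => p _.
      by rewrite inE; case: ifP.
    apply: eq_bigr => u' _; rewrite -sum1_card [RHS]big_mkcond; apply: eq_bigr => v _.
    by rewrite inE; case: ifP.
  rewrite big_mkcond; apply: leq_sum => {uL}u _; case: ifP => //; rewrite inE => /eqP uk.
  apply: leq_trans (_ : w (D u) <= _); first by rewrite -uk trunc_logP.
  rewrite wD; apply: subset_leq_card; apply/subsetP => v; rewrite !inE => /eqP vu.
  apply: le_trans (distD _ (D u) _) _; rewrite mul2n -addnn natrD mulrDl.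
  have lv : lev v = k by rewrite /lev vu.
  by have := levd u; have := levd v; rewrite uk lv vu distC => ? ?; rewrite lerD.
have tail : 2 ^ k0 * #|[set u | k0 <= lev u]| <= 4 * (A * k0 ^ 2).
  have [k0V|Vk0] := leqP k0 #|V|; last first.
    rewrite [X in 2 ^ k0 * X](_ : _ = 0) ?muln0 //; apply/eqP; rewrite cards_eq0.
    apply/eqP/setP => u; rewrite !inE; apply/negbTE; rewrite -ltnNge.
    apply: leq_ltn_trans Vk0; apply: leq_trans (ltnW (ltn_expl _ (isT : 1 < 2))) _.
    by apply: leq_trans (trunc_logP _ _) _ => //; rewrite wD max_card.
  apply: leq_trans (geometric_tail (x := fun k => #|L k|) k5 k0V Lk).
  rewrite leq_mul2l; apply/orP; right.
  have -> : \sum_(k0 <= k < #|V|) #|L k| = \sum_u \sum_(k0 <= k < #|V|) (lev u == k).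
    rewrite exchange_big; apply: eq_bigr => k _; rewrite -sum1_card big_mkcond.
    by apply: eq_bigr => u _; rewrite inE.
  rewrite -sum1_card big_mkcond; apply: leq_sum => u _; rewrite inE.
  case: ifP => // k0u.
  have uV : lev u < #|V|.
    apply: leq_trans (ltn_expl _ (isT : 1 < 2)) _.
    by apply: leq_trans (trunc_logP _ _) _ => //; rewrite wD max_card.
  rewrite (big_cat_nat k0u (ltnW uV)) /= [X in _ + X]big_ltn // eqxx.
  by rewrite addnCA leq_addr.
have light : #|[set u | lev u < k0]| <= 2 ^ k0 * #|[set x | 0 < w x]|.
  rewrite -sum1_card (partition_big D (mem [set x | 0 < w x])) /=; last first.
    by move=> u _; rewrite inE.
  rewrite mulnC -sum_nat_const; apply: leq_sum => v _.
  rewrite sum1_card; have [u /andP[]|no] := pickP [pred u | (u \in [set u | lev u < k0]) && (D u == v)].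
    rewrite inE => uk /eqP uv; apply: leq_trans (_ : w v <= _).
      by rewrite wD; apply: subset_leq_card; apply/subsetP => x /andP[_]; rewrite inE.
    rewrite -uv; apply: leq_trans (ltnW (trunc_log_ltn _ (isT : 1 < 2))) _.
    by rewrite leq_exp2l.
  by rewrite eq_card0.
have VE : #|V| = #|[set u | k0 <= lev u]| + #|[set u | lev u < k0]|.
  rewrite -(cardsC [set u | k0 <= lev u]); congr (_ + _); apply: eq_card => u.
  by rewrite !inE ltnNge.
have : 2 * #|[set u | k0 <= lev u]| <= #|V|.
  by rewrite -(leq_pmul2l (m := 2 ^ k0)) ?expn_gt0 //; lia.
by lia.
Qed.

End LowerBound.

(** * Second moment of the number of collisions *)

Section Collisions.
Variables (R : realFieldType) (I C : finType).
Implicit Types (f : {ffun I -> C}) (i j k l : I) (p q : I * I).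
Local Open Scope ring_scope.

Definition collisions f := #|[set p : I * I | f p.1 == f p.2]|.

Let M : R := #|C|%:R.
(** For uniform [f] and an off-diagonal pair [p], [Z f p] is [M] times the centred indicator of a
    collision. Its variance is [M - 1], and [B] is the sum of its squares over all [f]. *)
Let B : R := M ^+ #|I| * (M - 1).
Let Z f p : R := M * (f p.1 == f p.2)%:R - 1.

Let upd f i c : {ffun I -> C} := [ffun x => if x == i then c else f x].

(* Resampling the coordinate [i]: the map [(f, c) |-> (upd f i c, f i)] is an
   involution. *)
Lemma sum_upd (F : {ffun I -> C} -> R) i :
  M * \sum_f F f = \sum_f \sum_c F (upd f i c).
Proof.
rewrite pair_bigA /=.
pose s (x : {ffun I -> C} * C) := (upd x.1 i x.2, x.1 i).
have sK : involutive s.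
  move=> [f c]; rewrite /s /= ffunE eqxx; congr pair.
  by apply/ffunP => x; rewrite !ffunE; case: eqP => // ->.
rewrite (reindex_inj (inv_inj sK)) /=.
transitivity (\sum_(x : {ffun I -> C} * C) F x.1).
  rewrite -(pair_bigA _ (fun f _ => F f)) /= mulr_sumr; apply: eq_bigr => f _.
  by rewrite sumr_const mulr_natl.
apply: eq_bigr => -[f c] _ /=; congr F.
by apply/ffunP => x; rewrite !ffunE; case: eqP => // ->.
Qed.

Lemma sumZ f j : \sum_c (M * (c == f j)%:R - 1) = 0 :> R.
Proof.
rewrite sumrB sumr_const -mulr_sumr (bigD1 (f j)) //= eqxx big1 => [|c /negbTE ->] //.
by rewrite addr0 mulr1 subrr.
Qed.

Hypothesis C0 : (0 < #|C|)%N.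

(** Resampling the coordinate [p.1] leaves [Z f q] fixed and averages [Z f p] to zero. *)
Lemma Z_orthogonal p q : p.1 != p.2 -> p.1 != q.1 -> p.1 != q.2 ->
  \sum_f Z f p * Z f q = 0.
Proof.
case: p q => i j [k l] /= ij ik il.
have M0 : M != 0 by rewrite pnatr_eq0 -lt0n.
apply: (mulfI M0); rewrite (sum_upd _ i) mulr0 big1 // => f _.
transitivity ((\sum_c (M * (c == f j)%:R - 1)) * Z f (k, l)).
  rewrite mulr_suml; apply: eq_bigr => c _; rewrite /Z /= !ffunE eqxx.
  by rewrite ![_ == i]eq_sym (negbTE ij) (negbTE ik) (negbTE il).
by rewrite sumZ mul0r.
Qed.

Lemma Z_swap f i j : Z f (i, j) = Z f (j, i).
Proof. by rewrite /Z /= eq_sym. Qed.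

Lemma Z_sqr p : p.1 != p.2 -> \sum_f Z f p ^+ 2 = B.
Proof.
case: p => i j /= ij.
have M0 : M != 0 by rewrite pnatr_eq0 -lt0n.
apply: (mulfI M0); rewrite (sum_upd _ i).
have h f : \sum_c Z (upd f i c) (i, j) ^+ 2 = M * (M - 1).
  rewrite (eq_bigr (fun c => (M - 2) * (M * (c == f j)%:R - 1) + (M - 1))) => [|c _].
    by rewrite big_split -mulr_sumr sumZ mulr0 /= add0r sumr_const mulr_natl.
  rewrite /Z /= !ffunE eqxx [j == i]eq_sym (negbTE ij).
  by case: eqP => _ /=; rewrite ?mulr1 ?mulr0; ring.
rewrite (eq_bigr _ (fun f _ => h f)) sumr_const card_ffun -mulr_natl natrX.
by rewrite /B -/M; ring.
Qed.

(** Two pairs with different underlying sets are uncorrelated, as each has an element that the other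
    lacks. So [p] is correlated only with itself and its reversal, whence the factor 2. *)
Lemma collisions_variance :
  \sum_f (\sum_(p | p.1 != p.2) Z f p) ^+ 2 <= 2 * #|I|%:R ^+ 2 * B.
Proof.
have B0 : 0 <= B.
  by rewrite mulr_ge0 ?exprn_ge0 ?ler0n // subr_ge0 ler1n.
have -> : \sum_f (\sum_(p | p.1 != p.2) Z f p) ^+ 2 =
    \sum_(p | p.1 != p.2) \sum_(q | q.1 != q.2) \sum_f Z f p * Z f q.
  under eq_bigr do rewrite expr2 mulr_suml.
  rewrite exchange_big; apply: eq_bigr => p _; rewrite exchange_big.
  by apply: eq_bigr => f _; rewrite mulr_sumr.
have cov p q : p.1 != p.2 -> q.1 != q.2 -> \sum_f Z f p * Z f q <=
    ((q == p)%:R + (q == (p.2, p.1))%:R) * B.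
  case: p q => i j [k l] /= ij kl; rewrite !xpair_eqE.
  have [->|ki] := eqVneq k i; have [->|lj] := eqVneq l j => /=.
  - rewrite (eq_bigr (fun f => Z f (i, j) ^+ 2)) => [|f _]; last by rewrite expr2.
    by rewrite Z_sqr // (negbTE ij) addr0 mul1r.
  - rewrite (negbTE ij) add0r mul0r.
    have [E|jl] := eqVneq j l; first by rewrite E eqxx in lj.
    rewrite (eq_bigr (fun f => Z f (j, i) * Z f (i, l))) => [|f _].
      by rewrite Z_orthogonal //= eq_sym.
    by rewrite Z_swap.
  - rewrite (eq_sym j i) (negbTE ij) andbF add0r mul0r.
    have ik : i != k by rewrite eq_sym.
    by rewrite Z_orthogonal.
  rewrite add0r; have [kj|kj] := eqVneq k j; last first.
    rewrite mul0r; rewrite (eq_bigr (fun f => Z f (j, i) * Z f (k, l))) => [|f _].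
      by rewrite Z_orthogonal //= eq_sym.
    by rewrite Z_swap.
  have [li|li] := eqVneq l i; last first.
    by rewrite mul0r Z_orthogonal //= eq_sym.
  rewrite kj li mul1r (eq_bigr (fun f => Z f (i, j) ^+ 2)) => [|f _].
    by rewrite Z_sqr.
  by rewrite (Z_swap f j i) expr2.
apply: (@le_trans _ _ (\sum_(p : I * I) 2 * B)); last first.
  by rewrite sumr_const card_prod -(mulr_natl (2 * B)) natrM -expr2 mulrA [X in X * B]mulrC.
rewrite big_mkcond; apply: ler_sum => p _; case: ifP => pp; last by rewrite mulr_ge0.
apply: (@le_trans _ _ (\sum_q ((q == p)%:R + (q == (p.2, p.1))%:R) * B)).
  rewrite big_mkcond; apply: ler_sum => q _; case: ifP => qq; first exact: cov.
  by rewrite mulr_ge0 // addr_ge0.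
rewrite -mulr_suml big_split /= ler_wpM2r //.
have one p' : \sum_q (q == p')%:R = 1 :> R.
  by rewrite (bigD1 p') //= eqxx big1 ?addr0 // => q /negbTE ->.
by rewrite !one.
Qed.

(** Chebyshev's inequality in counting form. With [n] the cardinality of [I], the diagonal always
    gives [n] collisions, so the mean is [n + (n ^ 2 - n) / M], which the threshold rounds up. *)
Lemma collisions_tail (t : R) : 0 < t ->
  #|[set f | #|I|%:R + #|I|%:R ^+ 2 / M + t <= (collisions f)%:R]|%:R * (M * t ^+ 2)
    <= 2 * #|I|%:R ^+ 2 * M ^+ #|I|.
Proof.
move=> t0; have M0 : 0 < M by rewrite ltr0n.
set n : R := #|I|%:R; have n0 : 0 <= n by rewrite ler0n.
have ZE f : \sum_(p | p.1 != p.2) Z f p =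
    M * ((collisions f)%:R - n) - (n ^+ 2 - n).
  have dg : \sum_(p : I * I | ~~ (p.1 != p.2)) Z f p = n * (M - 1).
    rewrite (eq_bigr (fun=> M - 1)) => [|p /negPn/eqP pp]; last first.
      by rewrite /Z pp eqxx mulr1.
    rewrite sumr_const -mulr_natl; congr (_%:R * _).
    rewrite -(card_codom (f := fun x : I => (x, x))) => [|x y [] //].
    apply: eq_card => -[x y]; rewrite unfold_in negbK.
    by apply/eqP/codomP => [/= ->|[z [-> ->]] //]; exists y.
  have all_ : \sum_p Z f p = M * (collisions f)%:R - n ^+ 2.
    rewrite sumrB sumr_const card_prod natrM expr2 -mulr_sumr; congr (M * _ - _).
    rewrite /collisions -sum1_card natr_sum [RHS]big_mkcond.
    by apply: eq_bigr => p _; rewrite inE; case: eqP.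
  move: all_; rewrite (bigID (fun p => p.1 != p.2)) /= dg => h.
  by rewrite -[LHS](addrK (n * (M - 1))) h; ring.
rewrite -(ler_pM2l M0); apply: le_trans (_ : 2 * n ^+ 2 * B <= _); last first.
  rewrite /B [X in _ <= X](_ : _ = 2 * n ^+ 2 * (M ^+ #|I| * M)); last by ring.
  rewrite ler_wpM2l ?mulr_ge0 ?sqr_ge0 // ler_wpM2l ?exprn_ge0 ?(ltW M0) //.
  by lra.
apply: le_trans collisions_variance.
rewrite [X in X <= _](_ : _ = \sum_(f in
  [set f | n + n ^+ 2 / M + t <= (collisions f)%:R]) (M * t) ^+ 2); last first.
  by rewrite sumr_const -mulr_natl; ring.
rewrite big_mkcond; apply: ler_sum => f _; rewrite inE; case: ifP => h; last exact: sqr_ge0.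
have key : M * t <= \sum_(p | p.1 != p.2) Z f p.
  have : M * (n + n ^+ 2 / M + t) <= M * (collisions f)%:R by rewrite ler_pM2l.
  have -> : M * (n + n ^+ 2 / M + t) = M * n + n ^+ 2 + M * t by field; rewrite gt_eqF.
  by rewrite ZE mulrBr; lra.
have Mt : 0 <= M * t by rewrite mulr_ge0 ?ltW.
by rewrite ler_sqr ?nnegrE // (le_trans Mt).
Qed.

End Collisions.

(** * Grids of cells *)

Lemma sum_pairs (V C : finType) (f : {ffun V -> C}) (G : C -> C -> nat) :
  \sum_u \sum_v G (f u) (f v) =
  \sum_c \sum_d #|cell f c| * #|cell f d| * G c d.
Proof.
have fib (g : C -> nat) : \sum_v g (f v) = \sum_c #|cell f c| * g c.
  rewrite (partition_big f predT) //=; apply: eq_bigr => c _.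
  rewrite (eq_bigr (fun=> g c)) => [|v /eqP -> //].
  by rewrite sum_nat_const; congr (_ * _); apply: eq_card => v; rewrite inE.
under eq_bigr do rewrite fib.
rewrite (fib (fun c => \sum_d #|cell f d| * G c d)); apply: eq_bigr => c _.
by rewrite big_distrr /=; apply: eq_bigr => d _; rewrite mulnA.
Qed.

Lemma card_pairs (V : finType) (r : rel V) :
  #|[set p : V * V | r p.1 p.2]| = \sum_u \sum_v r u v.
Proof.
rewrite pair_bigA -sum1_card big_mkcond; apply: eq_bigr => p _.
by rewrite inE; case: (r _ _).
Qed.

Lemma collisionsE (V C : finType) (f : {ffun V -> C}) :
  collisions f = \sum_c #|cell f c| ^ 2.
Proof.
rewrite /collisions (card_pairs (fun u v => f u == f v)).
rewrite (sum_pairs f (fun c d => c == d)); apply: eq_bigr => c _.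
rewrite (bigD1 c) //= eqxx muln1 big1 ?addn0 // => d /negbTE.
by rewrite eq_sym => ->; rewrite muln0.
Qed.

Definition adjacent_cells m (c d : 'I_m * 'I_m) : bool :=
  [&& c.1 <= d.1.+1, d.1 <= c.1.+1, c.2 <= d.2.+1 & d.2 <= c.2.+1].

Lemma card_adjacent_cells m (c : 'I_m * 'I_m) :
  #|[set d | adjacent_cells c d]| <= 9.
Proof.
pose g (d : 'I_m * 'I_m) : 'I_3 * 'I_3 := (inord (d.1.+1 - c.1), inord (d.2.+1 - c.2)).
have -> : 9 = #|{: 'I_3 * 'I_3}| by rewrite card_prod !card_ord.
apply: (@leq_card_in _ _ g) => -[x y] [x' y']; rewrite !inE /adjacent_cells /=.
move=> /and4P[h1 h2 h3 h4] /and4P[h1' h2' h3' h4'] [].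
move=> /(congr1 val); rewrite /= !inordK ?ltnS; try lia; move=> e1.
move=> /(congr1 val); rewrite /= !inordK ?ltnS; try lia; move=> e2.
by congr pair; apply: val_inj => /=; lia.
Qed.

(** By [2 * x * y <= x ^ 2 + y ^ 2] for the sizes of adjacent cells, pairs across cells are paid for
    by pairs within cells. A cell is adjacent to at most 9 cells, itself included. *)
Lemma near_collisions m (V : finType) (f : {ffun V -> 'I_m * 'I_m}) (r : rel V) :
  (forall u v, r u v -> adjacent_cells (f u) (f v)) ->
  #|[set p : V * V | r p.1 p.2]| <= 9 * collisions f.
Proof.
move=> rf; rewrite card_pairs.
apply: leq_trans (_ : \sum_u \sum_v adjacent_cells (f u) (f v) <= _).
  apply: leq_sum => u _; apply: leq_sum => v _.
  by have := rf u v; case: (r u v) => // ->.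
rewrite (sum_pairs f (fun c d => adjacent_cells c d)) -(leq_pmul2l (m := 2)) //.
pose a (c d : 'I_m * 'I_m) : nat := adjacent_cells c d.
have aC c d : a c d = a d c.
  by rewrite /a /adjacent_cells; congr nat_of_bool; apply/and4P/and4P => -[].
have deg c : \sum_d a c d <= 9.
  apply: leq_trans (card_adjacent_cells c); rewrite -sum1_card [leqRHS]big_mkcond.
  by apply: leq_sum => d _; rewrite inE /a; case: adjacent_cells.
apply: (@leq_trans (\sum_c \sum_d (#|cell f c| ^ 2 * a c d + #|cell f d| ^ 2 * a d c))).
  rewrite big_distrr; apply: leq_sum => c _; rewrite big_distrr; apply: leq_sum => d _.
  rewrite (aC d c) /= -mulnDl mulnA leq_mul2r; apply/orP; right.
  by have [+ _] := nat_Cauchy #|cell f c| #|cell f d|; lia.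
have half (F : 'I_m * 'I_m -> nat) : \sum_c \sum_d F c * a c d <= 9 * \sum_c F c.
  rewrite big_distrr; apply: leq_sum => c _.
  by rewrite -big_distrr /= mulnC leq_mul2r deg orbT.
rewrite (eq_bigr _ (fun c _ => big_split _ _ _ _ _)) big_split /=.
rewrite [X in _ + X]exchange_big collisionsE /=.
by rewrite mul2n -addnn; apply: leq_add; exact: half.
Qed.

(** * Square blocks of a grid *)

Section Grid.
Variables (m K : nat) (V : finType) (e : rel V).
Variable f : {ffun V -> 'I_m * 'I_m}.
Hypothesis K0 : 0 < K.
Hypothesis adj : forall u v, u != v -> adjacent_cells (f u) (f v) -> e u v.

Let block (c : 'I_m * 'I_m) : 'I_(m %/ K).+1 * 'I_(m %/ K).+1 :=
  (inord (c.1 %/ K), inord (c.2 %/ K)).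

Let block1 (c : 'I_m * 'I_m) : ((block c).1 = c.1 %/ K :> nat).
Proof. by rewrite /= inordK // ltnS leq_div2r // ltnW. Qed.

Let block2 (c : 'I_m * 'I_m) : ((block c).2 = c.2 %/ K :> nat).
Proof. by rewrite /= inordK // ltnS leq_div2r // ltnW. Qed.

Let eq_block c d :
  (block c == block d) = (c.1 %/ K == d.1 %/ K) && (c.2 %/ K == d.2 %/ K).
Proof. by rewrite -(block1 c) -(block1 d) -(block2 c) -(block2 d) !val_eqE -pair_eqE. Qed.

Lemma card_block b : #|[set c | block c == b]| <= K ^ 2.
Proof.
pose g (c : 'I_m * 'I_m) : 'I_K * 'I_K :=
  (Ordinal (ltn_pmod c.1 K0), Ordinal (ltn_pmod c.2 K0)).
have -> : K ^ 2 = #|{: 'I_K * 'I_K}| by rewrite card_prod !card_ord.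
apply: (@leq_card_in _ _ g) => -[x y] [x' y']; rewrite !inE => /eqP <-.
rewrite eq_block /= => /andP[/eqP h1 /eqP h2] [h3 h4].
by congr pair; apply: val_inj; rewrite /= [LHS](divn_eq _ K) -?h1 ?h3 -?h2 ?h4 -divn_eq.
Qed.

Let down x := if x %% K == 0 then x else x.-1.

Let down_le x : down x <= x.
Proof. by rewrite /down; case: ifP => // _; rewrite leq_pred. Qed.

Let le_down x : x <= (down x).+1.
Proof. by rewrite /down; case: ifP => // _; lia. Qed.

Let down_div x : down x %/ K = x %/ K.
Proof.
rewrite /down; case: eqP => // /eqP; rewrite -lt0n => xK.
have -> : x.-1 = x %/ K * K + (x %% K).-1.
  by move: (x %/ K * K) (x %% K) (divn_eq x K) xK => a b; lia.
rewrite divnMDl // (@divn_small (x %% K).-1) ?addn0 //.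
exact: leq_ltn_trans (leq_pred _) (ltn_pmod x K0).
Qed.

Let down_mod x : down x %% K = (x %% K).-1.
Proof.
rewrite /down; case: eqP => [->//|/eqP]; rewrite -lt0n => xK.
have -> : x.-1 = x %/ K * K + (x %% K).-1.
  by move: (x %/ K * K) (x %% K) (divn_eq x K) xK => a b; lia.
by rewrite modnMDl modn_small //; exact: leq_ltn_trans (leq_pred _) (ltn_pmod x K0).
Qed.

(** A step lowers each coordinate until it is a multiple of [K]. Paths thus stay in their block, run
    diagonally and then straight to its corner, and have length [lev], which is less than [K]. *)
Let par (c : 'I_m * 'I_m) : 'I_m * 'I_m :=
  (Ordinal (leq_ltn_trans (down_le c.1) (ltn_ord c.1)),
   Ordinal (leq_ltn_trans (down_le c.2) (ltn_ord c.2))).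

Let lev (c : 'I_m * 'I_m) := maxn (c.1 %% K) (c.2 %% K).

Let lev_par c : lev (par c) = (lev c).-1.
Proof. by rewrite /lev /= !down_mod; lia. Qed.

(** A block without bad cells is merged into its corner. In the other blocks each cell is a clique
    and is merged separately; a bad cell spoils a single block, hence at most [K ^ 2] cells. *)
Lemma total_acquisition_number_le_grid i h :
  (forall k x, k < K -> x <= 2 ^ i -> helpers i x k < h) ->
  total_acquisition_number e <= (m %/ K).+1 ^ 2 +
    K ^ 2 * #|[set c | ~~ (K ^ 2 * h <= #|cell f c| <= 2 ^ i - h)]|.
Proof.
move=> hh; set Bad := [set c | _].
pose bad b := [exists d in Bad, block d == b].
pose J : finType := ('I_(m %/ K).+1 * 'I_(m %/ K).+1 + 'I_m * 'I_m)%type.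
pose g v : J := if bad (block (f v)) then inr (f v) else inl (block (f v)).
pose Q : {set J} := [set inl b | b in setT] :|:
  [set inr c | c in [set c | bad (block c)]].
apply: (@leq_trans #|Q|); first apply: (@total_acquisition_number_fibers V e _ g Q).
- move=> v; rewrite /g /Q inE; case: ifP => bv; apply/orP.
    by right; apply/imsetP; exists (f v); rewrite ?inE.
  by left; apply/imsetP; exists (block (f v)); rewrite ?inE.
- move=> v; have adj_same u u' : u != u' -> f u = f u' -> e u u'.
    by move=> uu E; apply: adj => //; rewrite E /adjacent_cells !leqnSn.
  have [bv|bv] := boolP (bad (block (f v))).
    have -> : [set x | g x == g v] = cell f (f v).
      apply/setP => x; rewrite !inE /g bv; case: ifP => bx.
        by apply/eqP/eqP => [[]|->].
      by apply/esym/eqP => E; rewrite E bv in bx.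
    have [||u _ mu] := @mergeable_clique V e _ f adj_same (f v) (cell f (f v)).
    + by apply/set0Pn; exists v; rewrite inE.
    + exact: subxx.
    by exists u.
  have -> : [set x | g x == g v] = [set x | block (f x) == block (f v)].
    apply/setP => x; rewrite !inE /g (negbTE bv); case: ifP => bx.
      by apply/esym/eqP => E; rewrite E (negbTE bv) in bx.
    by apply/eqP/eqP => [[h1 h2]|->] //; rewrite /block h1 h2.
  pose rt (x : 'I_m) : 'I_m := Ordinal (leq_ltn_trans (leq_divM x K) (ltn_ord x)).
  have [||u E|c|c|c x|c|u _ mu] := @mergeable_block V e _ f par lev
    (rt (f v).1, rt (f v).2) adj_same _ lev_par i h [set c | block c == block (f v)]
    [set x | block (f x) == block (f v)]; last by exists u.
  + move=> u u' uu E; apply: adj; first by rewrite eq_sym.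
    by rewrite E /adjacent_cells /= !le_down !(leqW (down_le _)).
  + by apply/set0Pn; exists v; rewrite inE.
  + by rewrite !inE in E *.
  + by rewrite !inE !eq_block /= !down_div.
  + rewrite inE eq_block => /andP[/eqP b1 /eqP b2] /eqP.
    rewrite /lev -leqn0 geq_max !leqn0 => /andP[/eqP m1 /eqP m2].
    rewrite [LHS]surjective_pairing; congr pair; apply: val_inj => /=.
      by rewrite {1}(divn_eq c.1 K) m1 addn0 b1.
    by rewrite {1}(divn_eq c.2 K) m2 addn0 b2.
  + by move=> _; apply: hh; rewrite gtn_max !ltn_pmod.
  + rewrite inE => cb; rewrite (setIidPr _); last first.
      by apply/subsetP => x; rewrite !inE => /eqP ->.
    have : c \notin Bad by apply: contra bv => cB; apply/existsP; exists c; rewrite cB.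
    rewrite inE negbK => /andP[h1 ->]; rewrite andbT; apply: leq_trans h1.
    by rewrite leq_mul2r card_block orbT.
apply: leq_trans (leq_card_setU _ _) _; apply: leq_add.
  apply: leq_trans (leq_imset_card _ _) _.
  by rewrite cardsT card_prod !card_ord.
apply: leq_trans (leq_imset_card _ _) _.
apply: leq_trans (_ : #|\bigcup_(d in Bad) [set c | block c == block d]| <= _).
  apply: subset_leq_card; apply/subsetP => c; rewrite inE => /existsP[d /andP[dB /eqP dc]].
  by apply/bigcupP; exists d; rewrite // inE dc.
rewrite mulnC -sum_nat_const; elim/big_rec2: _ => [|d x A _ h1]; first by rewrite cards0.
by apply: leq_trans (leq_card_setU _ _) _; rewrite leq_add // card_block.
Qed.

End Grid.

(** * Uniform points in the square *)

From mathcomp Require Import all_classical all_reals all_analysis.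
From mathcomp Require Import measurable_realfun.
Import numFieldNormedType.Exports.
Local Open Scope classical_set_scope.
Local Open Scope ring_scope.

Section GridIndex.
Variables (R : realType) (m : nat) (s : R).
Hypothesis s0 : 0 < s.
Implicit Types (x y : R) (a b : 'I_m.+1).

(* The minimum puts the right end point of [0, s] into the last cell. *)
Definition grid_index x : 'I_m.+1 := inord (minn (Num.truncn (x / s * m.+1%:R)) m).

Let side : R := s / m.+1%:R.
Let side0 : 0 < side. Proof. by rewrite divr_gt0. Qed.

Lemma grid_indexE x : grid_index x = minn (Num.truncn (x / s * m.+1%:R)) m :> nat.
Proof. by rewrite inordK // ltnS geq_minr. Qed.

(** The index 0 needs no condition on [x], since negative numbers are truncated to 0. Likewise the
    last cell is unbounded above, and the cells partition the whole line. *)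
Lemma grid_index_ge x a : (a <= grid_index x)%N = ((a : nat) == 0%N) || (a%:R * side <= x).
Proof.
have am : (a <= m)%N by rewrite -ltnS ltn_ord.
rewrite grid_indexE leq_min am andbT {am}.
case: (nat_of_ord a) => [//|k]; rewrite truncn_gt_nat /=.
rewrite /side -[RHS](ler_pM2r (x := m.+1%:R / s)) ?divr_gt0 //.
by congr (_ <= _); field; rewrite ?gt_eqF ?pnatr_eq0.
Qed.

Lemma grid_index_le x a : (grid_index x <= a)%N = ((a : nat) == m) || (x < a.+1%:R * side).
Proof.
rewrite grid_indexE geq_min truncn_le_nat orbC; congr (_ || _).
  have am : (a <= m)%N by rewrite -ltnS ltn_ord.
  by rewrite eqn_leq am.
rewrite /side -[RHS](ltr_pM2r (x := m.+1%:R / s)) ?divr_gt0 //.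
by congr (_ < _); field; rewrite ?gt_eqF ?pnatr_eq0.
Qed.

Lemma grid_index_itv x : 0 <= x <= s ->
  (grid_index x)%:R * side <= x <= (grid_index x).+1%:R * side.
Proof.
move=> /andP[x0 xs]; apply/andP; split.
  have := leqnn (grid_index x); rewrite grid_index_ge => /orP[/eqP ->|//].
  by rewrite mul0r.
have := leqnn (grid_index x); rewrite grid_index_le => /orP[/eqP ->|/ltW//].
by rewrite mulrC divfK // pnatr_eq0.
Qed.

Lemma grid_index_near x y : 0 <= x <= s -> 0 <= y <= s -> `|x - y| <= side ->
  (grid_index x <= (grid_index y).+1)%N.
Proof.
move=> xs ys xy; have /andP[x1 _] := grid_index_itv xs.
have := leqnn (grid_index y); rewrite grid_index_le => /orP[/eqP ->|y2].
  by rewrite leqW // -ltnS ltn_ord.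
rewrite -ltnS -(ltr_nat R) -(ltr_pM2r side0); apply: le_lt_trans x1 _.
rewrite -natr1 mulrDl mul1r; have := ler_norm (x - y); lra.
Qed.

Lemma grid_index_dist x y : 0 <= x <= s -> 0 <= y <= s ->
  (grid_index x <= (grid_index y).+1)%N -> (grid_index y <= (grid_index x).+1)%N ->
  `|x - y| <= 2 * side.
Proof.
move=> /grid_index_itv /andP[x1 x2] /grid_index_itv /andP[y1 y2].
have up a b : (a <= b.+1)%N -> a%:R * side <= b%:R * side + side.
  by rewrite -(ler_nat R) -(ler_pM2r side0) -(natr1 b) mulrDl mul1r.
move=> /up h1 /up h2.
move: x2 y2; rewrite -(natr1 (grid_index x)) -(natr1 (grid_index y)) !mulrDl !mul1r.
by move=> x2 y2; rewrite ler_norml; apply/andP; split; lra.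
Qed.

Lemma grid_index_preimage a : grid_index @^-1` [set a] =
  (if (a : nat) == 0%N then setT else [set` `[a%:R * side, +oo[]) `&`
  (if (a : nat) == m then setT else [set` `]-oo, a.+1%:R * side[]).
Proof.
apply/seteqP; split=> x /=; last first.
  move=> [h1 h2]; apply/val_inj/eqP; rewrite /= eqn_leq grid_index_ge grid_index_le.
  apply/andP; split; [move: h2|move: h1]; case: ifP => //= _; rewrite in_itv /=.
  by rewrite andbT.
move=> xa; have := leqnn (grid_index x); have := leqnn (grid_index x).
rewrite {2}xa {2}xa grid_index_ge grid_index_le => h1 h2.
by split; [move: h2|move: h1]; case: ifP => //= _; rewrite in_itv /= ?andbT.
Qed.

Lemma measurable_grid_index a : measurable (grid_index @^-1` [set a]).
Proof.
rewrite grid_index_preimage; apply: measurableI; case: ifP => _ //.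
Qed.

Lemma lebesgue_grid_index a :
  lebesgue_measure (grid_index @^-1` [set a] `&` `[0, s]) = side%:E.
Proof.
have a1 : a.+1%:R * side <= s.
  rewrite -[leRHS](@divfK _ m.+1%:R) ?pnatr_eq0 // mulrC ler_wpM2l ?(ltW side0) //.
  by rewrite ler_nat ltn_ord.
have a0 : 0 <= a%:R * side by rewrite mulr_ge0 // ltW.
have a2 : a.+1%:R * side = a%:R * side + side by rewrite -natr1 mulrDl mul1r.
have -> : grid_index @^-1` [set a] `&` `[0, s] =
    if (a : nat) == m then [set` `[a%:R * side, s]] else [set` `[a%:R * side, a.+1%:R * side[].
  rewrite grid_index_preimage; apply/seteqP; split=> x /=.
    rewrite in_itv /= => -[[h1 h2] /andP[x0 xs]].
    have h : a%:R * side <= x.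
      move: h1; case: ifP => [/eqP -> _|_] /=; first by rewrite mul0r.
      by rewrite in_itv /= andbT.
    by move: h2; case: ifP => _ /=; rewrite !in_itv /= h.
  move=> h; have {h} : [/\ a%:R * side <= x, x <= s & ((a : nat) == m) || (x < a.+1%:R * side)].
    move: h; case: ifP => _ /=; rewrite in_itv /= => /andP[-> h]; rewrite ?h //; split=> //.
    by rewrite (le_trans (ltW h)).
  move=> [h1 h2 h3]; split; last by rewrite in_itv /= h2 (le_trans a0).
  split; first by case: ifP => //= _; rewrite in_itv /= h1.
  by move: h3; case: ifP => //= _; rewrite in_itv.
case: ifP => [/eqP am|_]; rewrite lebesgue_measure_itv /= lte_fin.
  have ms : s = a%:R * side + side.
    by rewrite -a2 am mulrC divfK // pnatr_eq0.
  rewrite ifT; last by rewrite ms ltrDl.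
  by rewrite -EFinB {1}ms addrAC subrr add0r.
by rewrite ifT ?a2 ?ltrDl // -EFinB addrAC subrr add0r.
Qed.

End GridIndex.

(** * Random variables with finitely many values *)

Section FiniteValued.
Variables (R : realType) (d : measure_display) (T : measurableType d).
Variable P : probability T R.

Lemma measurable_finfun (I C : finType) (g : T -> {ffun I -> C}) f :
  (forall i c, measurable [set w | g w i = c]) -> measurable [set w | g w = f].
Proof.
move=> mg; have -> : [set w | g w = f] = \bigcap_(i in setT) [set w | g w i = f i].
  apply/seteqP; split=> w /= => [gw i _|h]; first by rewrite /= gw.
  by apply/ffunP => i; exact: h.
by apply: fin_bigcap_measurable => [|i _]; [exact: finite_finset|exact: mg].
Qed.

Variables (F : finType) (g : T -> F).
Hypothesis mg : forall f, measurable [set w | g w = f].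

Let preimageE (E : {pred F}) : [set w | g w \in E] =
  \big[setU/set0]_(f | f \in E) [set w | g w = f].
Proof.
apply/seteqP; split=> [w /= gE|w].
  by rewrite (bigD1 (g w)) //; left.
elim/big_ind: _ => [//|A B AE BE [/AE|/BE] //|f fE /= ->]; exact: fE.
Qed.

Lemma measurable_finite_valued (E : {pred F}) : measurable [set w | g w \in E].
Proof. by rewrite preimageE; exact: bigsetU_measurable. Qed.

Lemma prob_finite_valued (E : {pred F}) (p : R) :
  (forall f, P [set w | g w = f] = p%:E) ->
  (P [set w | g w \in E] <= (#|E|%:R * p)%:E)%E.
Proof.
move=> gp; rewrite preimageE -sum1_card natr_sum mulr_suml -sumEFin.
apply: (@le_trans _ _ (\sum_(f in E) P [set w | g w = f])%E); last first.
  by apply: lee_sum => f _; rewrite gp mul1r.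
have : measurable (\big[setU/set0]_(f in E) [set w | g w = f]) /\
   (P (\big[setU/set0]_(f in E) [set w | g w = f]) <=
     \sum_(f in E) P [set w | g w = f])%E; last by case.
elim/big_rec2: _ => [|f x A _ [mA PA]]; first by rewrite measure0.
split; first exact: measurableU.
by apply: le_trans (measureU2 _ _ _) _ => //; rewrite leeD2l.
Qed.

End FiniteValued.

Definition grid_cell (R : realType) m (s : R) (p : R * R) : 'I_m.+1 * 'I_m.+1 :=
  (grid_index m s p.1, grid_index m s p.2).

(** * Cells of independent uniform points *)

Section Cells.
Variables (R : realType) (n : nat) (d : measure_display) (T : measurableType d).
Variables (P : probability T R) (X : 'I_n -> {RV P >-> (R * R)%type}).
Hypothesis n0 : (0 < n)%N.
Hypothesis Xunif : forall i, uniform_in_square n (X i).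
Hypothesis Xindep : independent_RVs X.

Let s : R := Num.sqrt n%:R.
Let s0 : 0 < s. Proof. by rewrite sqrtr_gt0 ltr0n. Qed.

Let grid_cell_preimage m (c : 'I_m.+1 * 'I_m.+1) : grid_cell m s @^-1` [set c] =
  (grid_index m s @^-1` [set c.1]) `*` (grid_index m s @^-1` [set c.2]).
Proof.
case: c => a b; apply/seteqP; split=> -[x y] /=; rewrite /grid_cell /=.
  by move=> [-> ->].
by move=> [-> ->].
Qed.

Let measurable_grid_cell m (c : 'I_m.+1 * 'I_m.+1) :
  measurable (grid_cell m s @^-1` [set c]).
Proof.
by rewrite grid_cell_preimage; apply: measurableX; apply: measurable_grid_index.
Qed.

Let area_square : area (@square R n) = (s * s)%:E.
Proof.
rewrite /area /square product_measure1E //= lebesgue_measure_itv /=.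
by rewrite lte_fin s0 -EFinB subr0 EFinM.
Qed.

Lemma prob_grid_cell m c i :
  P (X i @^-1` (grid_cell m s @^-1` [set c])) = ((m.+1%:R ^+ 2)^-1)%:E.
Proof.
have := Xunif i (measurable_grid_cell c); rewrite /distribution /pushforward => ->.
rewrite area_square grid_cell_preimage -setXI /area product_measure1E; last 2 first.
- by apply: measurableI => //; exact: measurable_grid_index.
- by apply: measurableI => //; exact: measurable_grid_index.
rewrite /= !lebesgue_grid_index // -EFinM inver gt_eqF ?mulr_gt0 // -EFinM.
have k0 : m.+1%:R != 0 :> R by rewrite pnatr_eq0.
by congr EFin; move: (m.+1%:R : R) k0 => k k0; field; rewrite k0 gt_eqF.
Qed.

Let positions m (w : T) : {ffun 'I_n -> 'I_m.+1 * 'I_m.+1} :=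
  [ffun i => grid_cell m s (X i w)].


Let measurable_positions m f : measurable [set w | positions m w = f].
Proof.
apply: measurable_finfun => i c.
have -> : [set w | positions m w i = c] = X i @^-1` (grid_cell m s @^-1` [set c]).
  by apply/seteqP; split=> w; rewrite /= ffunE.
by rewrite -[X in measurable X]setTI; apply: measurable_funPT.
Qed.

(** By independence every map from points to cells has the same probability M^(-n), which turns the
    counting bound into a bound on probabilities. *)
Lemma prob_collisions m (t : R) : 0 < t ->
  let M := m.+1%:R ^+ 2 : R in
  let A := [set w | n%:R + n%:R ^+ 2 / M + t <= (collisions (positions m w))%:R] in
  measurable A /\ (P A <= (2 * n%:R ^+ 2 / (M * t ^+ 2))%:E)%E.
Proof.
move=> t0 M A; pose E := [pred f : {ffun 'I_n -> 'I_m.+1 * 'I_m.+1} |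
  n%:R + n%:R ^+ 2 / M + t <= (collisions f)%:R].
have -> : A = [set w | positions m w \in E] by [].
split; first by apply: measurable_finite_valued => f; exact: measurable_positions.
have Pf f : P [set w | positions m w = f] = (M^-1 ^+ n)%:E.
  have -> : [set w | positions m w = f] =
      [set w | forall i, i \in [set: 'I_n]%SET ->
        (grid_cell m s @^-1` [set f i]) (X i w)].
    apply/seteqP; split=> w /= => [<- i _|h]; first by rewrite ffunE.
    by apply/ffunP => i; rewrite ffunE h ?inE.
  rewrite (Xindep [set: _]%SET (A := fun i => grid_cell m s @^-1` [set f i])) //.
  rewrite (eq_bigr (fun=> M^-1%:E)) => [|i _]; last exact: prob_grid_cell.
  by rewrite prodEFin prodr_const cardsT card_ord.
apply: le_trans (prob_finite_valued (measurable_positions (m := m)) _ Pf) _.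
have M0 : 0 < M by rewrite exprn_gt0.
have := @collisions_tail R 'I_n ('I_m.+1 * 'I_m.+1)%type _ t t0.
rewrite card_prod !card_ord muln_gt0 /= => /(_ isT); rewrite natrM -expr2 -/M.
rewrite (eq_card (B := E)) => [|f]; last by rewrite inE.
rewrite lee_fin ler_pdivlMr ?mulr_gt0 ?exprn_gt0 // => h.
rewrite -(ler_pM2r (exprn_gt0 n M0)); apply: le_trans h.
by rewrite exprVn mulrAC divfK // gt_eqF ?exprn_gt0.
Qed.

Lemma prob_square : let A := [set w | forall i, square n (X i w)] in
  measurable A /\ P A = 1%E.
Proof.
have mS : measurable (@square R n) by apply: measurableX.
move=> A; have AE : A = [set w | forall i, i \in [set: 'I_n]%SET -> square n (X i w)].
  by apply/seteqP; split=> w /= h i; [move=> _; exact: h|apply: h; rewrite inE].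
split.
  have -> : A = \bigcap_(i in setT) (X i @^-1` @square R n).
    by apply/seteqP; split=> w /= h i; [move=> _; exact: h|exact: h].
  apply: fin_bigcap_measurable => [|i _]; first exact: finite_finset.
  by rewrite -[X in measurable X]setTI; apply: measurable_funPT.
rewrite AE (Xindep [set: _]%SET (A := fun=> @square R n)) // big1 // => i _.
have := Xunif i mS; rewrite /distribution /pushforward => ->.
by rewrite setIid area_square divee // eqe gt_eqF // mulr_gt0.
Qed.

End Cells.

(** * Bounds for a fixed point configuration *)

Section BadCells.
Variables (R : realFieldType) (V C : finType) (f : {ffun V -> C}).
Hypothesis C0 : (0 < #|C|)%N.
Let M : R := #|C|%:R.
Let mu : R := #|V|%:R / M.

(** The cell sizes sum to [#|V|] and their squares to the number of collisions. *)
Lemma sum_cell_deviation :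
  \sum_c (#|cell f c|%:R - mu) ^+ 2 = (collisions f)%:R - #|V|%:R * mu.
Proof.
have M0 : M != 0 by rewrite pnatr_eq0 -lt0n.
have cV : \sum_c #|cell f c|%:R = #|V|%:R :> R.
  rewrite -natr_sum; congr _%:R; rewrite -sum1_card (partition_big f predT) //=.
  by apply: eq_bigr => c _; rewrite sum1_card; apply: eq_card => v; rewrite !inE.
rewrite collisionsE natr_sum.
rewrite (eq_bigr (fun c => (#|cell f c| ^ 2)%:R - 2 * mu * #|cell f c|%:R + mu ^+ 2)) => [|c _].
  rewrite big_split sumrB /= -mulr_sumr cV sumr_const -mulr_natl -/M.
  by rewrite /mu; field.
by rewrite natrX; ring.
Qed.

(** The size of a bad cell is at least [mu / 2] away from [mu], so the cell contributes at least
    [mu ^+ 2 / 4] to the squared deviations. *)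
Lemma card_bad_cells (lo hi : nat) (b : R) : lo%:R <= mu / 2 -> 3 / 2 * mu <= hi%:R ->
  0 < mu -> (collisions f)%:R - #|V|%:R * mu <= b ->
  #|[set c | ~~ (lo <= #|cell f c| <= hi)%N]%SET|%:R * (mu ^+ 2 / 4) <= b.
Proof.
move=> lomu muhi mu0; apply: le_trans; rewrite -sum_cell_deviation.
rewrite mulr_natl -sumr_const [leLHS]big_mkcond; apply: ler_sum => c _; rewrite inE.
case: ifP => // [|_]; last exact: sqr_ge0.
rewrite negb_and -!ltnNge -!(ltr_nat R) => /orP[h|h].
  have : mu / 2 <= mu - #|cell f c|%:R by lra.
  by move: (_ - _) (opprB mu #|cell f c|%:R) => x <-; rewrite sqrrN => h1; nra.
by have : mu / 2 <= #|cell f c|%:R - mu; [lra | move: (_ - _) => x h1; nra].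
Qed.

End BadCells.

(* Paths of at most [a / 16] steps need fewer than [h = 2 ^ (9 a / 8 + O(1))]
   helpers, whereas a typical cell has at least [4 ^ a / 64] points. *)
Lemma block_parameters a : (16 <= a)%N ->
  let K := (a %/ 16).+1 in let h := (2 ^ (a + a %/ 8 + 2))%N in
  [/\ (a <= 16 * K)%N, (K <= a)%N, (K ^ 2 * h * 128 <= 4 ^ a)%N, (a ^ 2 <= 2 ^ a)%N &
   forall k y, (k < K)%N -> (y <= 2 ^ (2 * a).+1)%N ->
     (helpers (2 * a).+1 y k < h)%N].
Proof.
move=> a16 K h.
have Kq : (K <= 2 ^ (a %/ 16))%N by rewrite ltn_expl.
split; [by rewrite /K; lia|by rewrite /K; lia| | |].
- have : (K ^ 2 <= (2 ^ (a %/ 16)) ^ 2)%N by rewrite leq_exp2r.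
  move=> Kh; rewrite (_ : 128 = 2 ^ 7)%N // -mulnA -expnD.
  apply: leq_trans (leq_mul Kh (leqnn _)) _.
  rewrite -expnM -expnD (_ : 4 = 2 ^ 2)%N // -expnM leq_exp2l //; lia.
- rewrite -(subnK (leq_trans (isT : 4 <= 16)%N a16)); elim: (a - 4)%N => // j.
  by rewrite addSn (expnS 2 (j + 4)); move: (2 ^ (j + 4))%N => z; lia.
move=> k y kK /(helpers_sqr k) hk.
rewrite -(ltn_exp2r _ _ (isT : 0 < 2)%N); apply: leq_ltn_trans hk _.
by rewrite -expnM ltn_exp2l //; rewrite /K in kK; lia.
Qed.

(** * Configurations with few collisions *)

Section Deterministic.
Variables (R : realType) (n : nat) (x : 'I_n -> R * R).
Hypothesis n0 : (0 < n)%N.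
Hypothesis xS : forall i, square n (x i).

Let s : R := Num.sqrt n%:R.
Let s0 : 0 < s. Proof. by rewrite sqrtr_gt0 ltr0n. Qed.
Let ss : s ^+ 2 = n%:R. Proof. by rewrite sqr_sqrtr ?ler0n. Qed.

Let pos m : {ffun 'I_n -> 'I_m.+1 * 'I_m.+1} := [ffun i => grid_cell m s (x i)].

Let x1 i : 0 <= (x i).1 <= s. Proof. by have [] := xS i; rewrite /= !in_itv. Qed.
Let x2 i : 0 <= (x i).2 <= s. Proof. by have [] := xS i; rewrite /= !in_itv. Qed.

(** The maximum distance is bounded by the Euclidean one, so edges stay short, and it is compared
    with the grid coordinate by coordinate. *)
Let distm i j := Num.max `|(x i).1 - (x j).1| `|(x i).2 - (x j).2|.

(** Cells have side at least [q]; if [s < q], the truncation is 0 and its predecessor still gives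
    one cell. As [n / m.+1 ^ 2] is at most [4 * q ^ 2], there are at most [9 * n * q ^ 2]
    collisions, and adjacency of cells costs another factor 9. *)
Lemma near_pairs_le (q : nat) : (0 < q)%N ->
  let m := (Num.truncn (s / q%:R)).-1 in
  (collisions (pos m))%:R < n%:R + n%:R ^+ 2 / m.+1%:R ^+ 2 + n%:R ^+ 2 / m.+1%:R ^+ 2 :> R ->
  (near_pairs distm q%:R <= 81 * n * q ^ 2)%N.
Proof.
move=> q0 m coll; have q0' : 0 < q%:R :> R by rewrite ltr0n.
have q1 : 1 <= q%:R :> R by rewrite ler1n.
have M0 : 0 < m.+1%:R :> R by rewrite ltr0n.
have [adj M4] : (forall i j, distm i j <= q%:R -> adjacent_cells (pos m i) (pos m j)) /\
    s <= 2 * q%:R * m.+1%:R.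
  have [h|h] := leP 1 (s / q%:R); last first.
    have m0 : m = 0%N.
      have : ~~ (0 < Num.truncn (s / q%:R))%N by rewrite truncn_gt0 -ltNge.
      by rewrite /m; case: (Num.truncn _).
    split=> [i j _|].
      have I1 (a : 'I_m.+1) : a = 0%N :> nat by apply/eqP; rewrite -leqn0 -[leqRHS]m0 -ltnS ltn_ord.
      by rewrite /adjacent_cells !I1.
    rewrite m0 mulr1; rewrite ltr_pdivrMr // mul1r in h; lra.
  have mE : m.+1 = Num.truncn (s / q%:R) by rewrite /m prednK // truncn_gt0.
  have := truncn_itv (le_trans ler01 h); rewrite -mE => /andP[h1 h2].
  split=> [i j|]; last first.
    rewrite ltr_pdivrMr // -(natr1 m.+1) in h2.
    have : 1 <= m.+1%:R :> R by rewrite ler1n.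
    by move: (m.+1%:R : R) h2 => M h2 M1; nra.
  have qM : q%:R <= s / m.+1%:R by rewrite ler_pdivlMr // mulrC -ler_pdivlMr.
  rewrite ge_max => /andP[/le_trans/(_ qM) d1 /le_trans/(_ qM) d2].
  rewrite /adjacent_cells /pos !ffunE /=.
  by apply/and4P; split; apply: grid_index_near => //; rewrite distrC.
have := near_collisions (r := fun i j => distm i j <= q%:R) adj; rewrite -/(near_pairs _ _).
move=> /leq_trans; apply; rewrite -(ler_nat R) !natrM.
have nM : n%:R / m.+1%:R ^+ 2 <= 4 * q%:R ^+ 2 :> R.
  rewrite ler_pdivrMr ?exprn_gt0 // -ss (_ : 4 * _ * _ = (2 * q%:R * m.+1%:R) ^+ 2); last by ring.
  by rewrite ler_sqr ?nnegrE // ?ltW // !mulr_gt0.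
have n1 : 0 <= n%:R :> R by rewrite ler0n.
have key (N Q mu c : R) : 0 <= N -> 1 <= Q -> mu <= 4 * Q ^+ 2 ->
    c < N + N * mu + N * mu -> 9 * c <= 81 * N * (Q * Q).
  move=> N0 Q1 h1 h2; have h3 : N * mu <= N * (4 * Q ^+ 2) by rewrite ler_wpM2l.
  have h4 : N <= N * Q ^+ 2 by rewrite ler_peMr // exprn_ege1.
  lra.
by apply: key q1 nM _ => //; rewrite mulrA -expr2.
Qed.

Lemma acquisition_lower (a : nat) (r : R) : (0 < a)%N -> r <= (2 ^ a.+1)%:R ->
  (forall k, (0 < k)%N -> (2 ^ k <= n)%N ->
     let m := (Num.truncn (s / (2 * k * 2 ^ a.+1)%:R)).-1 in
     (collisions (pos m))%:R < n%:R + n%:R ^+ 2 / m.+1%:R ^+ 2 + n%:R ^+ 2 / m.+1%:R ^+ 2 :> R) ->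
  (n <= 2 ^ 27 * (4 ^ a * a ^ 2) * total_acquisition_number (geometric_graph r x))%N.
Proof.
move=> a0 ra coll.
(* Replacing [a] by a power of two between [a] and [2 * a] makes [2 ^ k0] an explicit product. *)
pose b := up_log 2 a.
have ab : (a <= 2 ^ b)%N by apply: up_logP.
have ba : (2 ^ b <= 2 * a)%N.
  have [a1|a1] : a = 1%N \/ (1 < a)%N by lia.
    by rewrite /b a1.
  have := up_log_bounds (isT : (1 < 2)%N) a1; rewrite -/b => /andP[h _].
  have b0 : (0 < b)%N by rewrite up_log_gt0.
  by rewrite -(prednK b0) expnS leq_mul2l /= ltnW.
have bla : (b <= a)%N by apply: up_log_min => //; rewrite ltnW // ltn_expl.
(* [2 ^ k0] has the order of [(2 ^ a * a) ^ 2], with a constant that makes it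
   exceed [8 * 324 * 4 ^ a.+1 * k0 ^ 2]. *)
pose k0 := (2 * a.+1 + 2 * b + 22)%N.
have h2k : (2 ^ k0 = 4 ^ a.+1 * (2 ^ b) ^ 2 * 2 ^ 22)%N.
  by rewrite /k0 2!expnD (expnM 2 2 a.+1) [(2 * b)%N]mulnC expnM.
(* With [q = 2 * k * 2 ^ a.+1] the bound [81 * n * q ^ 2] on close pairs is
   [324 * n * 4 ^ a.+1 * k ^ 2]. *)
have main := @total_acquisition_number_ge R 'I_n (geometric_graph r x) distm
  (2 ^ a.+1)%:R _ _ _ _ _ _ k0 (324 * n * 4 ^ a.+1).
have : (n <= 2 * (2 ^ k0 * total_acquisition_number (geometric_graph r x)))%N.
  rewrite -{1}(card_ord n); apply: main.
  - exact: ler0n.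
  - by move=> i; rewrite /geometric_graph eqxx.
  - move=> i j /andP[_ /le_trans/(_ ra)]; rewrite /euclid_dist => h.
    rewrite ge_max -!sqrtr_sqr; apply/andP; split; apply: le_trans h;
    by rewrite ler_wsqrtr // (lerDl, lerDr) sqr_ge0.
  - by move=> i; rewrite /distm !subrr normr0 maxxx.
  - by move=> i j; rewrite /distm distrC [X in Num.max _ X]distrC.
  - move=> i j k; rewrite ge_max.
    rewrite (le_trans (ler_distD (x j).1 _ _)) ?lerD ?le_max ?lexx ?orbT //.
    by rewrite (le_trans (ler_distD (x j).2 _ _)) ?lerD ?le_max ?lexx ?orbT.
  - by rewrite /k0; lia.
  - move=> k k0k; rewrite card_ord => kn.
    have k_gt0 : (0 < k)%N by apply: leq_trans k0k; rewrite /k0; lia.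
    rewrite -natrM; apply: leq_trans (near_pairs_le _ (coll k k_gt0 kn)) _.
      by rewrite !muln_gt0 k_gt0 expn_gt0.
    have -> : (4 ^ a.+1 = (2 ^ a.+1) ^ 2)%N by rewrite -expnM mulnC expnM.
    by rewrite !expnMn; move: ((2 ^ a.+1) ^ 2)%N => z; lia.
  - rewrite card_ord h2k.
    (* The constants fit because 8 * 324 = 2592 is at most 2^12 and 28^2 is at most 2^10. *)
    have : (k0 ^ 2 <= (28 * a) ^ 2)%N by rewrite leq_exp2r // /k0; lia.
    have : (a ^ 2 <= (2 ^ b) ^ 2)%N by rewrite leq_exp2r.
    rewrite expnMn; move: (4 ^ a.+1)%N ((2 ^ b) ^ 2)%N (k0 ^ 2)%N (a ^ 2)%N => p q k c h1 h2.
    have h3 : (2592 * k <= q * 2 ^ 22)%N.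
      rewrite (_ : 22 = 12 + 10)%N // expnD mulnCA; apply: leq_mul => //.
      by apply: leq_trans h2 _; rewrite mulnC; apply: leq_mul.
    move: (2 ^ 22)%N h3 => z h3.
    rewrite (_ : 8 * _ = (n * p) * (2592 * k))%N; last by lia.
    by rewrite (_ : _ * n = (n * p) * (q * z))%N ?leq_mul2l ?h3 ?orbT //; lia.
move=> /leq_trans; apply; rewrite mulnA leq_mul2r; apply/orP; right.
have : ((2 ^ b) ^ 2 <= (2 * a) ^ 2)%N by rewrite leq_exp2r.
rewrite h2k (expnS 4 a) (expnMn 2 a); move: (4 ^ a)%N ((2 ^ b) ^ 2)%N (a ^ 2)%N => p q c h.
rewrite (_ : 27 = 22 + 5)%N // expnD; move: (2 ^ 22)%N => z.
rewrite (_ : 2 * _ = (8 * z * p) * q)%N; last by lia.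
by rewrite (_ : z * _ * _ = (8 * z * p) * (2 ^ 2 * c))%N ?leq_mul2l ?h ?orbT //; lia.
Qed.

(** With [u = 2 ^ a], cells have side between [u / 8] and [u / 4], so points in adjacent cells are
    within distance [u] and the mean cell size lies between [u ^ 2 / 64] and [u ^ 2 / 16]. Blocks
    and cells in spoilt blocks are then both O(n / (u a)^2) in number. *)
Lemma acquisition_upper (a : nat) (r : R) : (16 <= a)%N -> (2 ^ a)%:R <= r ->
  (4 ^ a * a ^ 2 <= n)%N ->
  (let m := Num.truncn (s / ((2 ^ a)%:R / 4)) in
   (collisions (pos m))%:R < n%:R + n%:R ^+ 2 / m.+1%:R ^+ 2 + n%:R :> R) ->
  (total_acquisition_number (geometric_graph r x) * (4 ^ a * a ^ 2) <= 2 ^ 17 * n)%N.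
Proof.
move=> a16 ar an; set m := Num.truncn _ => /= coll.
have [aK Ka hK a2 hh] := block_parameters a16.
set K := (a %/ 16).+1 in aK Ka hK hh; set h := (2 ^ (a + a %/ 8 + 2))%N in hK hh.
set u : R := (2 ^ a)%:R in m coll ar.
have u1 : 1 <= u by rewrite /u ler1n expn_gt0.
have u0 : 0 < u by apply: lt_le_trans u1.
have uu : u ^+ 2 = (4 ^ a)%:R by rewrite /u -natrX -expnM mulnC expnM.
have aR : 16 <= a%:R :> R by rewrite ler_nat.
pose y : R := s / (u / 4).
have y4 : 4 * a%:R <= y.
  have : u * a%:R <= s.
    rewrite -ler_sqr ?nnegrE ?mulr_ge0 ?(ltW u0) ?(ltW s0) // ss exprMn uu -natrX -natrM.
    by rewrite ler_nat.
  by rewrite /y => us; rewrite ler_pdivlMr ?divr_gt0 //; lra.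
have y0 : 0 <= y by lra.
have /andP[m1 m2] := truncn_itv y0; rewrite -/m in m1 m2.
pose M1 : R := m.+1%:R.
have yM : y <= M1 by exact: ltW.
have My : M1 <= 2 * y by rewrite /M1 -natr1; lra.
have M1_gt0 : 0 < M1 by lra.
have yE : y ^+ 2 * u ^+ 2 = 16 * n%:R by rewrite /y -ss; field; rewrite gt_eqF.
have N0 : 0 < n%:R :> R by rewrite ltr0n.
pose mu : R := n%:R / M1 ^+ 2.
have muM : mu * M1 ^+ 2 = n%:R by rewrite /mu divfK // gt_eqF ?exprn_gt0.
have mu_gt0 : 0 < mu by rewrite /mu divr_gt0 ?exprn_gt0.
have y2M : y ^+ 2 <= M1 ^+ 2 by rewrite ler_sqr ?nnegrE //; lra.
have M2y : M1 ^+ 2 <= 4 * y ^+ 2.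
  rewrite (_ : 4 * _ = (2 * y) ^+ 2); last by ring.
  by rewrite ler_sqr ?nnegrE //; lra.
have u2_gt0 : 0 < u ^+ 2 by rewrite exprn_gt0.
have mu_ge : u ^+ 2 <= 64 * mu.
  rewrite -(ler_pM2r (exprn_gt0 2 M1_gt0)) -(mulrA 64) muM.
  have : u ^+ 2 * M1 ^+ 2 <= u ^+ 2 * (4 * y ^+ 2) by rewrite ler_pM2l.
  rewrite (_ : u ^+ 2 * (4 * _) = 4 * (y ^+ 2 * u ^+ 2)); last by ring.
  by rewrite yE; lra.
have mu_le : 16 * mu <= u ^+ 2.
  rewrite -(ler_pM2r (exprn_gt0 2 M1_gt0)) -(mulrA 16) muM -yE.
  by rewrite mulrC ler_pM2l.
have adj (i j : 'I_n) : i != j -> adjacent_cells (pos m i) (pos m j) ->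
    geometric_graph r x i j.
  move=> ij; rewrite /adjacent_cells /pos !ffunE /= => /and4P[h1 h2 h3 h4].
  rewrite /geometric_graph ij /=; apply: le_trans ar.
  have d1 := grid_index_dist s0 (x1 i) (x1 j) h1 h2.
  have d2 := grid_index_dist s0 (x2 i) (x2 j) h3 h4.
  have su : 4 * (s / m.+1%:R) <= u.
    have h5 : s = y * (u / 4) by rewrite /y divfK // gt_eqF ?divr_gt0.
    rewrite mulrA ler_pdivrMr // {1}h5 -/M1.
    have : y * u <= M1 * u by rewrite ler_pM2r.
    lra.
  move: (s / _) d1 d2 su => side d1 d2 su.
  rewrite /euclid_dist -[leRHS](ger0_norm (ltW u0)) -(sqrtr_sqr u); apply: ler_wsqrtr.
  have side0 : 0 <= 2 * side by apply: le_trans (normr_ge0 _) d1.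
  rewrite -[(_ - _) ^+ 2]real_normK ?num_real // -[X in _ + X]real_normK ?num_real //.
  move: d1 d2; rewrite -ler_sqr ?nnegrE // => d1; rewrite -ler_sqr ?nnegrE // => d2.
  apply: le_trans (lerD d1 d2) _.
  have : (4 * side) ^+ 2 <= u ^+ 2 by rewrite ler_sqr ?nnegrE //; lra.
  have := sqr_ge0 side; lra.
have K0 : (0 < K)%N by [].
have := @total_acquisition_number_le_grid m.+1 K 'I_n _ (pos m) K0 adj _ h hh.
set bad := #|_|; set t := total_acquisition_number _ => tle.
have C0 : (0 < #|{: 'I_m.+1 * 'I_m.+1}|)%N by rewrite card_prod !card_ord.
have M1E : #|{: 'I_m.+1 * 'I_m.+1}|%:R = M1 ^+ 2 :> R.
  by rewrite card_prod !card_ord natrM -expr2.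
have hR : K%:R ^+ 2 * h%:R * 128 <= u ^+ 2 :> R.
  by rewrite uu -natrX -!natrM ler_nat.
have h1 : 1 <= h%:R :> R by rewrite ler1n expn_gt0.
have K1 : 1 <= K%:R :> R by rewrite ler1n.
(* There are at most [2 * n] collisions beyond [n * mu], which bounds the sum of the squared
   deviations. *)
have badle : bad%:R * (mu ^+ 2 / 4) <= 2 * n%:R.
  have := @card_bad_cells R 'I_n _ (pos m) C0 (K ^ 2 * h) (2 ^ (2 * a).+1 - h) (2 * n%:R).
  rewrite M1E card_ord -/mu; apply=> //.
  - rewrite natrM natrX; lra.
  - have hu : h%:R <= u ^+ 2.
      apply: le_trans hR; rewrite -mulrA; have := exprn_ege1 2 K1.
      move: (K%:R ^+ 2) => k k1; nra.
    rewrite natrB; last first.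
      by rewrite -(ler_nat R) expnS expnM natrM -uu; lra.
    by rewrite expnS expnM natrM -uu; lra.
  - have -> : n%:R * mu = n%:R ^+ 2 / M1 ^+ 2 by rewrite /mu mulrA -expr2.
    rewrite -/M1 in coll; rewrite lerBlDr; apply: le_trans (ltW coll) _.
    by rewrite addrAC -mulr2n mulr_natl.
have aKR : a%:R <= 16 * K%:R :> R by rewrite -natrM ler_nat.
have KaR : K%:R <= a%:R :> R by rewrite ler_nat.
have a2R : a%:R ^+ 2 <= u by rewrite -natrX ler_nat.
rewrite -(ler_nat R) (natrM R t) (natrM R (4 ^ a)) -uu (natrX R a 2).
(* The blocks will use 256 and the spoilt cells 128 of the factor 2^9, each multiplied by
   [256 * n]. *)
rewrite (natrM R (2 ^ 17)) (_ : 17 = 8 + 9)%N // expnD natrM.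
have tleR : t%:R <= ((m.+1 %/ K)%:R + 1) ^+ 2 + K%:R ^+ 2 * bad%:R :> R.
  by rewrite natr1 -!natrX -natrM -natrD ler_nat.
(* Rounding up the number of blocks per side costs a factor 2, since [K <= a <= y <= M1]. *)
have blocks : ((m.+1 %/ K)%:R + 1) * K%:R <= 2 * M1.
  have : (m.+1 %/ K)%:R * K%:R <= M1 by rewrite -natrM ler_nat leq_divM.
  lra.
have b1 : ((m.+1 %/ K)%:R + 1) ^+ 2 * (u ^+ 2 * a%:R ^+ 2) <= 256 * (256 * n%:R).
  have B0 : 0 <= ((m.+1 %/ K)%:R + 1) ^+ 2 :> R by exact: sqr_ge0.
  have h2 : a%:R ^+ 2 <= 256 * K%:R ^+ 2 :> R.
    rewrite (_ : 256 * _ = (16 * K%:R) ^+ 2); last by ring.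
    by rewrite ler_sqr ?nnegrE //; lra.
  have h3 : ((m.+1 %/ K)%:R + 1) ^+ 2 * K%:R ^+ 2 <= 4 * M1 ^+ 2.
    rewrite (_ : 4 * _ = (2 * M1) ^+ 2); last by ring.
    by rewrite -exprMn ler_sqr ?nnegrE ?mulr_ge0 ?addr_ge0 //; lra.
  move: (_ ^+ 2) (K%:R ^+ 2) (a%:R ^+ 2) B0 h2 h3 => B k A B0 h2 h3.
  apply: (@le_trans _ _ (256 * u ^+ 2 * (B * k))).
    rewrite (_ : 256 * _ * _ = B * (u ^+ 2 * (256 * k))); last by ring.
    by rewrite ler_wpM2l // ler_wpM2l // ltW.
  have : u ^+ 2 * (B * k) <= u ^+ 2 * (16 * y ^+ 2) by rewrite ler_wpM2l ?(ltW u2_gt0) //; lra.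
  rewrite (_ : u ^+ 2 * (16 * _) = 16 * (y ^+ 2 * u ^+ 2)); last by ring.
  by rewrite yE; lra.
have b2 : K%:R ^+ 2 * bad%:R * (u ^+ 2 * a%:R ^+ 2) <= 128 * (256 * n%:R).
  have h2 : K%:R ^+ 2 * a%:R ^+ 2 <= u ^+ 2.
    apply: (@le_trans _ _ (a%:R ^+ 2 * a%:R ^+ 2)).
      by rewrite ler_wpM2r ?sqr_ge0 // ler_sqr ?nnegrE //; lra.
    by rewrite -[leLHS]expr2 ler_sqr ?nnegrE ?sqr_ge0 ?(ltW u0).
  have h3 : u ^+ 2 * u ^+ 2 <= 64 * (64 * mu ^+ 2).
    rewrite (_ : 64 * (64 * _) = (64 * mu) ^+ 2); last by ring.
    have mu64 : 0 <= 64 * mu by rewrite mulr_ge0 // ltW.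
    by rewrite -[leLHS]expr2 ler_sqr ?nnegrE ?(ltW u2_gt0).
  have bad0 : 0 <= bad%:R :> R by exact: ler0n.
  rewrite (_ : _ * _ = bad%:R * (u ^+ 2 * (K%:R ^+ 2 * a%:R ^+ 2))); last by ring.
  apply: (@le_trans _ _ (bad%:R * (u ^+ 2 * u ^+ 2))).
    by rewrite ler_wpM2l // ler_wpM2l ?(ltW u2_gt0).
  apply: (@le_trans _ _ (bad%:R * (64 * (64 * mu ^+ 2)))); first by rewrite ler_wpM2l.
  rewrite (_ : bad%:R * _ = 128 * (128 * (bad%:R * (mu ^+ 2 / 4)))); last by field.
  lra.
have : t%:R * (u ^+ 2 * a%:R ^+ 2) <=
    (((m.+1 %/ K)%:R + 1) ^+ 2 + K%:R ^+ 2 * bad%:R) * (u ^+ 2 * a%:R ^+ 2).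
  by rewrite ler_wpM2r // mulr_ge0 // ?sqr_ge0.
lra.
Qed.

End Deterministic.

(** * Asymptotic bounds *)

Section MeasurableAcquisition.
Variables (R : realType) (n : nat) (d : measure_display) (T : measurableType d).
Variables (P : probability T R) (X : 'I_n -> {RV P >-> (R * R)%type}) (r : R).
Hypothesis r0 : 0 < r.

Lemma measurable_close i j :
  measurable [set w | euclid_dist (X i w) (X j w) <= r].
Proof.
pose g w := ((X i w).1 - (X j w).1) ^+ 2 + ((X i w).2 - (X j w).2) ^+ 2.
have -> : [set w | euclid_dist (X i w) (X j w) <= r] = g @^-1` `]-oo, r ^+ 2].
  have gE w : (Num.sqrt (g w) <= r) = (g w <= r ^+ 2).
    by rewrite -{1}(ger0_norm (ltW r0)) -(sqrtr_sqr r) ler_sqrt ?sqr_ge0.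
  by apply/seteqP; split=> w; rewrite /= in_itv /= /euclid_dist gE.
have mfst k : measurable_fun setT (fun w => (X k w).1).
  by apply: measurableT_comp => //; exact: measurable_funPT.
have msnd k : measurable_fun setT (fun w => (X k w).2).
  by apply: measurableT_comp => //; exact: measurable_funPT.
have mg : measurable_fun setT g.
  by apply: measurable_funD; apply: measurable_funM; exact: measurable_funB.
by rewrite -[X in measurable X]setTI; apply: mg.
Qed.

(** The acquisition number depends on [w] only through the adjacency matrix, which takes finitely
    many values and has measurable entries. *)
Lemma measurable_acquisition (Q : pred nat) : measurable
  [set w | Q (total_acquisition_number (geometric_graph r (fun i => X i w)))].
Proof.
pose g w : {ffun 'I_n * 'I_n -> bool} :=
  [ffun p => geometric_graph r (fun i => X i w) p.1 p.2].
have gE w : geometric_graph r (fun i => X i w) = fun i j => g w (i, j).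
  by apply/funext => i; apply/funext => j; rewrite ffunE.
pose E := [pred f : {ffun 'I_n * 'I_n -> bool} | Q (total_acquisition_number (fun i j => f (i, j)))].
have -> : [set w | Q (total_acquisition_number (geometric_graph r (fun i => X i w)))] =
    [set w | g w \in E].
  by apply/seteqP; split=> w /=; rewrite inE gE.
apply: measurable_finite_valued => f; apply: measurable_finfun => -[i j] c.
have m1 : measurable [set w | g w (i, j) = true].
  have [ij|ij] := boolP (i == j).
    rewrite (_ : [set _ | _] = set0) //; apply/seteqP; split=> w //=.
    by rewrite ffunE /geometric_graph ij.
  have -> : [set w | g w (i, j) = true] =
      [set w | euclid_dist (X i w) (X j w) <= r].
    by apply/seteqP; split=> w /=; rewrite ffunE /geometric_graph ij.
  exact: measurable_close.
case: c => //; rewrite (_ : [set _ | _] = ~` [set w | g w (i, j) = true]).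
  exact: measurableC.
by apply/seteqP; split=> w /=; [move=> ->|move/negP/negbTE].
Qed.

End MeasurableAcquisition.

(** * Failure probabilities of the two bounds *)

Section Probability.
Variables (R : realType) (n : nat) (d : measure_display) (T : measurableType d).
Variables (P : probability T R) (X : 'I_n -> {RV P >-> (R * R)%type}) (r : R).
Hypothesis r0 : 0 < r.
Hypothesis n0 : (0 < n)%N.
Hypothesis Xunif : forall i, uniform_in_square n (X i).
Hypothesis Xindep : independent_RVs X.

Let s : R := Num.sqrt n%:R.
Let s0 : 0 < s. Proof. by rewrite sqrtr_gt0 ltr0n. Qed.
Let s1 : 1 <= s. Proof. by rewrite -sqrtr1 ler_wsqrtr // ler1n. Qed.
Let ss : s ^+ 2 = n%:R. Proof. by rewrite sqr_sqrtr ?ler0n. Qed.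
Let at_ w := total_acquisition_number (geometric_graph r (fun i => X i w)).

(** The deterministic bounds need all points in the square. This is only almost sure, and discarding
    the null event costs nothing. *)
Let prob_not_square (B E : set T) (p : R) : measurable B -> measurable E ->
  (P B <= p%:E)%E ->
  (forall w, (forall i, square n (X i w)) -> ~ B w -> E w) ->
  (P (~` E) <= p%:E)%E.
Proof.
move=> mB mE Bp BE; have [mS PS] := prob_square n0 Xunif Xindep.
set S := [set w | _] in mS PS.
apply: (@le_trans _ _ (P (~` S `|` B))).
  apply: le_measure; rewrite ?inE; [exact: measurableC|apply: measurableU => //; exact: measurableC|].
  move=> w /= nE; have [Sw|nS] := pselect (S w); last by left.
  by right; apply: contrapT => nB; apply: nE; exact: BE.
apply: le_trans (measureU2 _ _ _) _ => //; first exact: measurableC.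
by rewrite /= probability_setC // PS subee // add0e.
Qed.

Lemma prob_lower a : (0 < a)%N -> r <= (2 ^ a.+1)%:R ->
  (P (~` [set w | (n <= 2 ^ 27 * (4 ^ a * a ^ 2) * at_ w)%N]) <= (4 / s)%:E)%E.
Proof.
move=> a0 ra; pose q k := (2 * k * 2 ^ a.+1)%N; pose m k := (Num.truncn (s / (q k)%:R)).-1.
pose M k : R := (m k).+1%:R ^+ 2.
pose B k := [set w | n%:R + n%:R ^+ 2 / M k + n%:R ^+ 2 / M k <=
  (collisions [ffun i => grid_cell (m k) s (X i w)])%:R :> R].
have M0 k : 0 < M k by rewrite exprn_gt0.
have N0 : 0 < n%:R :> R by rewrite ltr0n.
have PB k : (0 < k)%N -> measurable (B k) /\ (P (B k) <= (2 / n%:R)%:E)%E.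
  move=> k0; have t0 : 0 < n%:R ^+ 2 / M k by rewrite divr_gt0 // exprn_gt0.
  have [mB PB] := prob_collisions n0 Xunif Xindep (m k) t0.
  split=> //; apply: le_trans PB _; rewrite lee_fin -/(M k).
  (* Chebyshev gives 2 M / n^2, and [M k <= n] because there are at most [s] cells per side. *)
  have -> : 2 * n%:R ^+ 2 / (M k * (n%:R ^+ 2 / M k) ^+ 2) = 2 / n%:R * (M k / n%:R).
    by move: (M0 k); move: (M k) => x x0; field; rewrite !gt_eqF.
  rewrite ler_piMr ?divr_ge0 ?(ltW N0) // ler_pdivrMr // mul1r -ss /M.
  rewrite ler_sqr ?nnegrE // ?(ltW s0) //.
  have [tz|t_gt0] := posnP (Num.truncn (s / (q k)%:R)); first by rewrite /m tz.
  rewrite /m prednK //; apply: le_trans (_ : s / (q k)%:R <= _).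
    by rewrite truncn_le divr_ge0 // ltW.
  have q1 : 1 <= (q k)%:R :> R by rewrite ler1n /q !muln_gt0 k0 expn_gt0.
  by rewrite ler_pdivrMr ?(lt_le_trans ltr01 q1) // ler_peMr // ltW.
pose L := trunc_log 2 n.
(* Only scales up to [trunc_log 2 n] matter. This logarithm is at most [2 * s], so the sum of the
   errors [2 / n] is at most [4 / s]. *)
have LE : (P (\big[setU/set0]_(1 <= k < L.+1) B k) <= (4 / s)%:E)%E.
  have : measurable (\big[setU/set0]_(1 <= k < L.+1) B k) /\
    (P (\big[setU/set0]_(1 <= k < L.+1) B k) <= (\sum_(1 <= k < L.+1) 2 / n%:R)%:E)%E.
    rewrite big_nat [X in (X)%:E]big_nat.
    elim/big_rec2: _ => [|k p A /andP[k0 _] [mA PA]]; first by rewrite measure0.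
    have [mB PBk] := PB k k0; split; first exact: measurableU.
    by apply: le_trans (measureU2 _ _ _) _ => //; rewrite EFinD leeD.
  case=> _ /le_trans; apply; rewrite lee_fin sumr_const_nat subn1 /=.
  have L2 : L%:R <= 2 * s :> R.
    rewrite -ler_sqr ?nnegrE ?mulr_ge0 ?(ltW s0) // exprMn ss -!natrX -natrM ler_nat.
    apply: (@leq_trans (2 ^ 2 * 2 ^ L)); last by rewrite leq_mul2l trunc_logP // orbT.
    elim: L => // l; rewrite (expnS 2 l); case: l => [|[|[|l]]] // IH.
    by move: (2 ^ l.+3)%N IH => z; lia.
  rewrite -mulr_natr ler_pdivlMr // (_ : _ * s = 2 * (L%:R * s) / n%:R); last by ring.
  rewrite ler_pdivrMr // -ss.
  have : L%:R * s <= 2 * s * s by rewrite ler_pM2r.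
  lra.
apply: prob_not_square LE _.
- by rewrite big_nat; apply: bigsetU_measurable => k /andP[k0 _]; have [] := PB k k0.
- exact: (measurable_acquisition X r0 (fun t => n <= 2 ^ 27 * (4 ^ a * a ^ 2) * t)%N).
move=> w Sw nB; apply: acquisition_lower => // k k0 kn; cbv zeta; rewrite ltNge; apply/negP => h.
apply: nB; rewrite -bigcup_seq; exists k => //=.
by rewrite mem_index_iota k0 ltnS trunc_log_max.
Qed.

(** Chebyshev gives at most 4^a / n. This is at most 4^A / n for [a < A], and at most 1/A otherwise
    because [4 ^ a * a ^ 2 <= n]. The threshold [A] makes the bound uniform in [a]. *)
Lemma prob_upper a (A : nat) : (16 <= a)%N -> (2 ^ a)%:R <= r ->
  (4 ^ a * a ^ 2 <= n)%N -> (0 < A)%N ->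
  (P (~` [set w | (at_ w * (4 ^ a * a ^ 2) <= 2 ^ 17 * n)%N]) <=
    (A%:R^-1 + (4 ^ A)%:R / n%:R)%:E)%E.
Proof.
move=> a16 ra an A0; pose y : R := s / ((2 ^ a)%:R / 4).
pose m := Num.truncn y; pose M : R := m.+1%:R ^+ 2.
have N0 : 0 < n%:R :> R by rewrite ltr0n.
have [mB PB] := prob_collisions n0 Xunif Xindep m N0.
rewrite -/M in mB PB; set B := [set w | _] in mB PB.
have u0 : 0 < (2 ^ a)%:R :> R by rewrite ltr0n expn_gt0.
have y0 : 0 < y by rewrite !divr_gt0.
have yM : y ^+ 2 <= M by rewrite /M ler_sqr ?nnegrE ?(ltW y0) // ltW // truncnS_gt.
have yE : y ^+ 2 * (4 ^ a)%:R = 16 * n%:R.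
  have -> : (4 ^ a)%:R = (2 ^ a)%:R ^+ 2 :> R by rewrite -natrX -expnM mulnC expnM.
  by rewrite /y -ss; field; rewrite gt_eqF.
have q0 : 0 < (4 ^ a)%:R :> R by rewrite ltr0n expn_gt0.
have M0 : 0 < M by rewrite exprn_gt0.
have PB' : (P B <= (A%:R^-1 + (4 ^ A)%:R / n%:R)%:E)%E.
  apply: le_trans PB _; rewrite lee_fin.
  have -> : 2 * n%:R ^+ 2 / (M * n%:R ^+ 2) = 2 / M by field; rewrite !gt_eqF.
  apply: (@le_trans _ _ ((4 ^ a)%:R / n%:R)).
    rewrite ler_pdivrMr // mulrAC ler_pdivlMr //.
    have : y ^+ 2 * (4 ^ a)%:R <= M * (4 ^ a)%:R by rewrite ler_pM2r.
    by rewrite yE mulrC; lra.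
  have [aA|Aa] := ltnP a A.
    apply: ler_wpDl; first by rewrite invr_ge0.
    by rewrite ler_pM2r ?invr_gt0 // ler_nat leq_exp2l // ltnW.
  apply: ler_wpDr; first by rewrite divr_ge0.
  rewrite ler_pdivrMr // mulrC ler_pdivlMr ?ltr0n // -natrM ler_nat.
  apply: leq_trans an; rewrite leq_mul2l; apply/orP; right.
  by apply: leq_trans Aa _; rewrite -mulnn leq_pmulr //; lia.
apply: prob_not_square PB' _ => //.
  exact: (measurable_acquisition X r0 (fun t => t * (4 ^ a * a ^ 2) <= 2 ^ 17 * n)%N).
move=> w Sw nB; apply: acquisition_upper => //=; rewrite ltNge; apply/negP => h.
exact: nB.
Qed.

End Probability.

(** * Dyadic approximation of the order of magnitude *)

Section Order.
Variable R : realType.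
Implicit Types (r : R) (a b n : nat).

Let ln2_gt0 : 0 < ln 2 :> R. Proof. by rewrite ln_gt0 // ltr1n. Qed.

Lemma lg_exp2 a : lg ((2 ^ a)%:R : R) = a%:R.
Proof. by rewrite /lg natrX lnXn // mulrnAl divff // gt_eqF. Qed.

Lemma ler_lg : {in Num.pos &, {mono (@lg R) : x y / x <= y}}.
Proof. by move=> x y x0 y0; rewrite /lg ler_pM2r ?invr_gt0 // ler_ln. Qed.

Lemma dyadic_bracket r : 2 <= r ->
  exists2 a, (0 < a)%N & (2 ^ a)%:R <= r <= (2 ^ a.+1)%:R.
Proof.
move=> r2; have r0 : 0 <= r by lra.
have /andP[t1 t2] := truncn_itv r0; set t := Num.truncn r in t1 t2.
have t_ge2 : (2 <= t)%N by rewrite truncn_ge_nat.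
have t0 : (0 < t)%N by apply: leq_trans t_ge2.
exists (trunc_log 2 t); first by rewrite trunc_log_gt0.
apply/andP; split.
  by apply: le_trans t1; rewrite ler_nat trunc_logP.
apply: le_trans (ltW t2) _; rewrite ler_nat.
exact: (trunc_log_ltn _ (isT : (1 < 2)%N)).
Qed.

Lemma rlg_bounds r a : (0 < a)%N -> (2 ^ a)%:R <= r <= (2 ^ a.+1)%:R ->
  (4 ^ a * a ^ 2)%:R <= (r * lg r) ^+ 2 <= 16 * (4 ^ a * a ^ 2)%:R /\ 0 < r * lg r.
Proof.
move=> a0 /andP[r1 r2].
have u0 : 0 < (2 ^ a)%:R :> R by rewrite ltr0n expn_gt0.
have r0 : 0 < r by apply: lt_le_trans r1.
have a1 : 1 <= a%:R :> R by rewrite ler1n.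
have l1 : a%:R <= lg r by rewrite -lg_exp2 ler_lg ?posrE.
have l2 : lg r <= a%:R + 1.
  by rewrite natr1 -lg_exp2 ler_lg ?posrE // ltr0n expn_gt0.
have E : (4 ^ a * a ^ 2)%:R = ((2 ^ a)%:R * a%:R) ^+ 2 :> R.
  by rewrite exprMn -!natrX -natrM -expnM (mulnC a 2) expnM.
have rl0 : 0 < r * lg r by rewrite mulr_gt0 //; lra.
split=> //; rewrite E (_ : 16 * _ = (4 * ((2 ^ a)%:R * a%:R)) ^+ 2); last by ring.
have ua : 0 <= (2 ^ a)%:R * a%:R :> R by rewrite mulr_ge0 // ltW.
rewrite !ler_sqr ?nnegrE ?(ltW rl0) ?mulr_ge0 //.
rewrite ler_pM ?(ltW u0) ?(le_trans ler01) //=.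
rewrite expnS natrM in r2.
apply: (@le_trans _ _ (2 * (2 ^ a)%:R * (2 * a%:R))); last by lra.
by apply: ler_pM => //; lra.
Qed.

(* The order of magnitude is compared with [n / G a] for the lower bound, where
   [G a = (2 ^ a * a) ^ 2] and [2 ^ a] is within a factor 2 of [r], and with
   [n / G b] for the upper bound, where [b <= a] is capped so that [G b <= n]. *)
Lemma acq_order_dyadic n r : (4 <= n)%N -> 0 < r -> exists a b (F : R),
  [/\ [/\ (0 < a)%N, r <= (2 ^ a.+1)%:R, (4 ^ b * b ^ 2 <= n)%N &
          (1 < b)%N -> (2 ^ b)%:R <= r],
   Order.min n%:R%:E (acq_order n r) = F%:E, 0 < F,
   (forall t, (0 < t)%N -> (n <= 2 ^ 27 * (4 ^ a * a ^ 2) * t)%N -> F <= 2 ^+ 30 * t%:R) &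
   n%:R <= 16 * (4 ^ b * b ^ 2)%:R * F].
Proof.
move=> n4 r0; have n4R : 4 <= n%:R :> R by rewrite ler_nat.
have z30 : 2 ^+ 30 = 2 ^+ 27 * 8 :> R.
  by rewrite -[30%N]/(27 + 3)%N exprD; congr (_ * _); rewrite !exprS expr0; lra.
have z0 : 0 < 2 ^+ 27 :> R by rewrite exprn_gt0.
have low a t : (n <= 2 ^ 27 * (4 ^ a * a ^ 2) * t)%N ->
    n%:R <= 2 ^+ 27 * (4 ^ a * a ^ 2)%:R * t%:R :> R.
  by rewrite -natrX -!natrM ler_nat.
have s2 : 2 <= Num.sqrt n%:R :> R.
  by rewrite -(@ger0_norm R 2) // -sqrtr_sqr ler_wsqrtr // expr2; lra.
(* Below 2 the product [r * lg r] is at most 2, so the order is [n] up to a factor 4, and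
   [a = b = 1] will do. *)
have [r2|r2] := ltP r 2.
  have [F [FE F0 Fn nF]] : exists F, [/\ Order.min n%:R%:E (acq_order n r) = F%:E, 0 < F,
      F <= n%:R & n%:R <= 4 * F].
    rewrite /acq_order; have [r1|r1] := ltP r 1.
      by exists n%:R; rewrite minxx; split=> //; lra.
    have l0 : 0 <= lg r by rewrite /lg divr_ge0 ?(ltW ln2_gt0) ?ln_ge0.
    have l1 : lg r <= 1 by rewrite -[leRHS]/(1%:R) -(lg_exp2 1) ler_lg ?posrE // expn1 ltW.
    have rl : r * lg r <= 2 by rewrite -[leRHS]mulr1 ler_pM // ltW.
    (* A vanishing [r * lg r] makes the quotient [+oo], and the minimum is [n]. *)
    rewrite (le_trans rl s2) inver; case: eqP => [E|/eqP E].
      exists n%:R; rewrite mulry gtr0_sg ?mul1e ?ltr0n ?(leq_trans _ n4) //.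
      by rewrite min_l ?leey //; split=> //; lra.
    set x := (r * lg r) ^+ 2 in E *.
    have x0 : 0 < x by rewrite lt_neqAle eq_sym E sqr_ge0.
    have x4 : x <= 4.
      have -> : 4 = 2 ^+ 2 :> R by rewrite expr2; lra.
      have rl_ge0 : 0 <= r * lg r := mulr_ge0 (ltW r0) l0.
      by rewrite /x ler_sqr ?nnegrE.
    exists (Num.min n%:R (n%:R / x)); rewrite -EFinM -EFin_min; split=> //.
    - by rewrite lt_min divr_gt0 ?andbT //; lra.
    - by rewrite ge_min lexx.
    have : n%:R / 4 <= n%:R / x by rewrite ler_wpM2l ?lef_pV2 ?posrE //.
    by case: (leP n%:R (n%:R / x)); lra.
  exists 1%N, 1%N, F; split=> //.
  - by split=> //; lra.
  - move=> t t0 /low h; apply: le_trans Fn (le_trans h _).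
    rewrite ler_wpM2r // z30 ler_wpM2l ?(ltW z0) // natrM; lra.
  by move: nF; rewrite natrM; lra.
have [a a0 /[dup] ra /andP[ra1 ra2]] := dyadic_bracket r2.
have [/andP[G1 G2] rl0] := rlg_bounds a0 ra.
(* Consecutive values of [G] have ratio at most 4 * 4, so the largest [b] with [G b <= n] still
   satisfies [n <= 16 * G b]. *)
have GG b : (4 ^ b.+1 * b.+1 ^ 2)%:R <= 16 * (4 ^ b * b ^ 2)%:R :> R \/ b = 0%N.
  case: b => [|b]; [by right|left; rewrite -natrM ler_nat (expnS 4 b.+1)].
  have h : (b.+2 ^ 2 <= 2 ^ 2 * b.+1 ^ 2)%N.
    by rewrite -expnMn leq_exp2r // mul2n -addnn addnS ltnS leq_addr.
  rewrite -mulnA; apply: leq_trans (leq_mul (leqnn 4) (leq_mul (leqnn _) h)) _.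
  by rewrite (mulnCA (4 ^ b.+1)%N) mulnA.
have r1 : (r < 1) = false by apply/negbTE; rewrite -leNgt; lra.
rewrite /acq_order r1.
have [rs|rs] := leP (r * lg r) (Num.sqrt n%:R).
  have x_gt0 : 0 < (r * lg r) ^+ 2 by rewrite exprn_gt0.
  have xn : (r * lg r) ^+ 2 <= n%:R.
    by rewrite -[leRHS](@sqr_sqrtr R) ?ler0n // ler_sqr ?nnegrE ?sqrtr_ge0 ?(ltW rl0).
  have x1 : 1 <= (r * lg r) ^+ 2.
    by apply: le_trans G1; rewrite ler1n muln_gt0 !expn_gt0 a0.
  rewrite inver gt_eqF // -EFinM -EFin_min.
  move: ((r * lg r) ^+ 2) G1 G2 x_gt0 xn x1 => x G1 G2 x0 xn x1.
  have G0 : 0 < (4 ^ a * a ^ 2)%:R :> R by lra.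
  exists a, a, (n%:R / x); split=> //.
  - by split=> //; rewrite -(ler_nat R); apply: le_trans xn.
  - by congr EFin; rewrite min_r // ler_pdivrMr // ler_peMr //; lra.
  - by rewrite divr_gt0 //; lra.
  - move=> t t0 /low h; rewrite ler_pdivrMr //; apply: le_trans h _.
    rewrite mulrAC ler_pM ?mulr_ge0 ?(ltW z0) ?(ltW G0) //.
    by rewrite ler_wpM2r // z30 ler_peMr ?(ltW z0) //; lra.
  by rewrite mulrA ler_pdivlMr // mulrC ler_wpM2r.
have nG : n%:R < 16 * (4 ^ a * a ^ 2)%:R :> R.
  apply: lt_le_trans G2; rewrite -[ltLHS](@sqr_sqrtr R) ?ler0n //.
  by rewrite ltr_sqr ?nnegrE ?sqrtr_ge0 ?(ltW rl0).
pose Q b := [&& (0 < b)%N, (b <= a)%N & (4 ^ b * b ^ 2 <= n)%N].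
have exQ : exists b, Q b by exists 1%N; rewrite /Q a0.
have Qa b : Q b -> (b <= a)%N by case/and3P.
have [b /and3P[b0 ba bn] bmax] := ex_maxnP exQ Qa.
exists a, b, 1; split=> //.
- split=> // _; apply: le_trans ra1; by rewrite ler_nat leq_exp2l.
- by rewrite min_r // lee_fin; lra.
- by move=> t t0 _; rewrite -[leLHS]mulr1 ler_pM ?ler1n // exprn_ege1 // ler1n.
rewrite mulr1; have [<-|bna] := eqVneq a b; first exact: ltW.
have : ~~ Q b.+1 by apply/negP => /bmax; rewrite ltnn.
rewrite /Q /= ltn_neqAle eq_sym bna ba /= -ltnNge -(ltr_nat R) => h.
by have [/(lt_le_trans h)/ltW//|b00] := GG b; rewrite b00 in b0.
Qed.

End Order.

Lemma cvg_probability1 (R : realType) (d : nat -> measure_display)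
    (T : forall n, measurableType (d n)) (P : forall n, probability (T n) R)
    (A : forall n, set (T n)) :
  (forall n, measurable (A n)) ->
  (forall eps : R, 0 < eps -> \forall n \near \oo, (P n (~` A n) <= eps%:E)%E) ->
  P n (A n) @[n --> \oo] --> 1%E.
Proof.
move=> mA small; have fA n : P n (A n) \is a fin_num by exact: fin_num_measure.
apply/fine_cvgP; split; first by apply: nearW => n; exact: fA.
apply/cvgrPdist_le => eps /small; apply: filterS => n.
rewrite probability_setC // -(fineK (fA n)) -EFinB lee_fin /= => h.
rewrite ger0_norm // subr_ge0 -lee_fin fineK //; exact: probability_le1.
Qed.

(** * Combination of the two bounds *)

Section Theta.
Variables (R : realType) (r : nat -> R) (d : nat -> measure_display).
Variables (T : forall n, measurableType (d n)) (P : forall n, probability (T n) R).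
Variable X : forall n, 'I_n -> {RV (P n) >-> (R * R)%type}.
Hypothesis r0 : forall n, 0 < r n.
Hypothesis Xunif : forall n (i : 'I_n), uniform_in_square n (@X n i).
Hypothesis Xindep : forall n, independent_RVs (@X n).

Let at_ n (w : T n) :=
  total_acquisition_number (geometric_graph (r n) (fun i => @X n i w)).

Let cl : R := (2 ^+ 30)^-1.
(** The summand [2 ^+ 17] serves the exponents [b >= 16]. The other one dominates [4 ^ b * b ^ 2]
    for smaller [b], where the trivial bound [n] is good enough. *)
Let cu : R := 16 * (2 ^+ 17 + 4 ^+ 16 * 16 ^+ 2).

Let cl0 : 0 < cl. Proof. by rewrite invr_gt0 exprn_gt0. Qed.
Let cu0 : 0 < cu.
Proof. by rewrite mulr_gt0 // addr_gt0 ?mulr_gt0 ?exprn_gt0. Qed.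

Lemma prob_order n (F : R) (A : nat) : (4 <= n)%N -> (0 < A)%N ->
  Order.min n%:R%:E (acq_order n (r n)) = F%:E ->
  (P n (~` [set w : T n | (cl * F <= (at_ w)%:R <= cu * F)%R]) <=
    (4 / Num.sqrt n%:R + (A%:R^-1 + (4 ^ A)%:R / n%:R))%:E)%E.
Proof.
move=> n4 A0 FE; have n0 : (0 < n)%N by apply: leq_trans n4.
have [a [b [F' [[a0 ra bn rb]]]]] := acq_order_dyadic n4 (r0 n).
rewrite FE => -[<-] F0 low up.
have Plow := prob_lower (r0 n) n0 (@Xunif n) (@Xindep n) a0 ra.
set E1 := [set w | _] in Plow.
have mE1 : measurable E1.
  exact: (measurable_acquisition (@X n) (r0 n) (fun t => n <= 2 ^ 27 * (4 ^ a * a ^ 2) * t)%N).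
have [E2 [mE2 PE2 E2w]] : exists E2 : set (T n), [/\ measurable E2,
    (P n (~` E2) <= (A%:R^-1 + (4 ^ A)%:R / n%:R)%:E)%E &
    forall w, E2 w -> (at_ w)%:R <= cu * F].
  have [b16|b16] := leqP 16 b; last first.
    exists setT; split=> // [|w _].
      rewrite setCT measure0 lee_fin addr_ge0 ?divr_ge0 ?invr_ge0 //.
    apply: le_trans (_ : n%:R <= _).
      rewrite ler_nat; apply: leq_trans (total_acquisition_number_le (s := [::]) _) _ => //.
      by apply: leq_trans (max_card _) _; rewrite card_ord.
    apply: le_trans up _; rewrite /cu ler_wpM2r ?(ltW F0) // ler_wpM2l //.
    rewrite (natrM _ (4 ^ b)) (natrX _ 4 b) (natrX _ b 2).
    apply: ler_wpDl; first by rewrite exprn_ge0.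
    apply: ler_pM; rewrite ?exprn_ge0 //.
      by apply: ler_weXn2l; rewrite ?ler1n // ltnW.
    by rewrite ler_sqr ?nnegrE // ler_nat ltnW.
  exists [set w | (at_ w * (4 ^ b * b ^ 2) <= 2 ^ 17 * n)%N]; split.
  - exact: (measurable_acquisition (@X n) (r0 n) (fun t => t * (4 ^ b * b ^ 2) <= 2 ^ 17 * n)%N).
  - by apply: prob_upper => //; apply: rb; apply: leq_trans b16.
  move=> w /=; rewrite -(ler_nat R) (natrM _ (at_ w)) (natrM _ (2 ^ 17)) (natrX _ 2 17) => h.
  have G0 : 0 < (4 ^ b * b ^ 2)%:R :> R.
    by rewrite ltr0n muln_gt0 !expn_gt0 /= (leq_trans _ b16).
  rewrite -(ler_pM2r G0); apply: le_trans h _.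
  have z0 : 0 <= 2 ^+ 17 :> R by rewrite exprn_ge0.
  apply: le_trans (ler_wpM2l z0 up) _.
  have reorder (x y z : R) : x * (16 * y * z) = 16 * x * z * y by ring.
  rewrite reorder.
  rewrite ler_wpM2r ?(ltW G0) // ler_wpM2r ?(ltW F0) // /cu ler_wpM2l // lerDl.
  by rewrite mulr_ge0 // exprn_ge0.
apply: (@le_trans _ _ (P n (~` E1 `|` ~` E2))).
  apply: le_measure; rewrite ?inE.
  - apply: measurableC.
    exact: (measurable_acquisition (@X n) (r0 n) (fun t => cl * F <= t%:R <= cu * F)).
  - by apply: measurableU; exact: measurableC.
  move=> w /= nG; have [E1w|] := pselect (E1 w); last by left.
  right=> E2w'; apply: nG; rewrite (E2w _ E2w') andbT.
  have t0 : (0 < at_ w)%N.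
    rewrite lt0n; apply: contraL n0 => /eqP t0; move: E1w.
    by rewrite /E1 /= -/(at_ w) t0 muln0 leqn0 => /eqP ->.
  by rewrite /cl mulrC ler_pdivrMr ?exprn_gt0 // mulrC; exact: low.
apply: le_trans (measureU2 _ _ _) _; [exact: measurableC|exact: measurableC|].
by rewrite EFinD leeD.
Qed.

(** The factor [D] admits functions that exceed the minimum with [n] by a bounded factor; it is
    charged to the lower constant. *)
Lemma aas_Theta_acquisition (D : R) (f : nat -> \bar R) : 0 < D ->
  (\forall n \near \oo, exists F F', [/\ f n = F'%:E, F <= F' <= D * F &
     Order.min n%:R%:E (acq_order n (r n)) = F%:E]) ->
  aas_Theta P at_ f.
Proof.
move=> D0 [N0 _ fN]; exists (cl / D), cu; split=> //; first by rewrite divr_gt0.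
apply: cvg_probability1 => [n|eps eps0].
  exact: (measurable_acquisition (@X n) (r0 n)
    (fun t => ((cl / D)%:E * f n <= t%:R%:E <= cu%:E * f n)%E)).
(* [A], [N1] and [N2] each bring one of the three error terms below [eps / 3]. [A] is fixed first,
   as [N1] depends on it. *)
pose A := (Num.truncn (3 / eps)).+1.
pose N1 := (Num.truncn ((4 ^ A)%:R * 3 / eps)).+1.
pose N2 := (Num.truncn ((12 / eps) ^+ 2)).+1.
exists (4 + N0 + N1 + N2)%N => // n /= nN.
have n4 : (4 <= n)%N by apply: leq_trans nN; rewrite -!addnA leq_addr.
have nN0 : (N0 <= n)%N by apply: leq_trans nN; rewrite -!addnA addnCA leq_addr.
have [F [F' [fE FF' minE]]] := fN n nN0.
have n0 : 0 < n%:R :> R by rewrite ltr0n (leq_trans _ n4).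
have A1 : A%:R^-1 <= eps / 3 :> R.
  rewrite -[leRHS]invrK invf_div lef_pV2 ?posrE ?divr_gt0 // ltW //.
  exact: truncnS_gt.
have h1 : (4 ^ A)%:R / n%:R <= eps / 3 :> R.
  have : (4 ^ A)%:R * 3 / eps <= n%:R.
    apply: le_trans (ltW (truncnS_gt _)) _; rewrite ler_nat -/N1.
    by apply: leq_trans nN; rewrite -addnA addnCA leq_addr.
  by rewrite !ler_pdivrMr //; lra.
have h2 : 4 / Num.sqrt n%:R <= eps / 3 :> R.
  have : 12 / eps <= Num.sqrt n%:R.
    rewrite -[leLHS](@ger0_norm R) ?divr_ge0 ?(ltW eps0) // -sqrtr_sqr ler_wsqrtr //.
    apply: le_trans (ltW (truncnS_gt _)) _; rewrite ler_nat -/N2.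
    by apply: leq_trans nN; rewrite leq_addl.
  by rewrite !ler_pdivrMr ?sqrtr_gt0 //; lra.
apply: (@le_trans _ _ (P n (~` [set w : T n | (cl * F <= (at_ w)%:R <= cu * F)%R]))).
  apply: le_measure; rewrite ?inE.
  - apply: measurableC; exact: (measurable_acquisition (@X n) (r0 n)
      (fun t => ((cl / D)%:E * f n <= t%:R%:E <= cu%:E * f n)%E)).
  - apply: measurableC.
    exact: (measurable_acquisition (@X n) (r0 n) (fun t => cl * F <= t%:R <= cu * F)).
  apply: subsetC => w /= /andP[l1 l2]; rewrite fE -!EFinM !lee_fin.
  have /andP[F1 F2] := FF'; apply/andP; split.
    apply: le_trans l1; rewrite -mulrA ler_wpM2l ?(ltW cl0) //.
    by rewrite ler_pdivrMl // mulrC.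
  by apply: le_trans l2 _; rewrite ler_wpM2l // ltW.
apply: le_trans (prob_order n4 (ltn0Sn _) minE) _; rewrite lee_fin -/A.
apply: (@le_trans _ _ (eps / 3 + (eps / 3 + eps / 3))); last by lra.
by apply: lerD h2 (lerD A1 h1).
Qed.

End Theta.

(** If [r n] tends to 1 from above, [acq_order] outgrows the trivial bound [n]. Hence the first part
    takes the minimum with [n], and the second keeps [r n] out of the interval from 1 to
    [1 + eps]. *)
Theorem theorem1p1 (R : realType) (r : nat -> R) (hr : forall n, 0 < r n)
    (d : nat -> measure_display) (T : forall n, measurableType (d n))
    (P : forall n, probability (T n) R)
    (X : forall n, 'I_n -> {RV (P n) >-> (R * R)%type})
    (hunif : forall n (i : 'I_n), uniform_in_square n (X n i))
    (hindep : forall n, independent_RVs (X n)) :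
  let a n (w : T n) :=
    total_acquisition_number (geometric_graph (r n) (fun i => X n i w)) in
  aas_Theta P a (fun n => Order.min n%:R%:E (acq_order n (r n))) /\
  (forall eps : R, 0 < eps ->
     (\forall n \near \oo, r n < 1 \/ 1 + eps <= r n) ->
     aas_Theta P a (fun n => acq_order n (r n))).
Proof.
move=> a.
have minF : \forall n \near \oo, exists2 F : R, 0 < F &
    Order.min n%:R%:E (acq_order n (r n)) = F%:E.
  exists 4%N => // n /= n4.
  by have [? [? [F [_ FE F0 _ _]]]] := acq_order_dyadic n4 (hr n); exists F.
split=> [|eps eps0 reps].
  apply: (aas_Theta_acquisition hr hunif hindep (D := 1)) => //.
  by apply: filterS minF => n [F F0 FE]; exists F, F; rewrite mul1r lexx.
(* Above [1 + eps] the product [r * lg r] is at least [L], so the quotient exceeds [n] at most by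
   the factor 1 / L^2. *)
pose L := (1 + eps) * lg (1 + eps).
have L0 : 0 < L by rewrite mulr_gt0 ?divr_gt0 ?ln_gt0 ?ltrDl ?addr_gt0 // ltr1n.
have L2 : 0 < L ^+ 2 by rewrite exprn_gt0.
apply: (aas_Theta_acquisition hr hunif hindep (D := 1 + (L ^+ 2)^-1)).
  by rewrite addr_gt0 // invr_gt0.
near=> n.
have n1 : 1 <= n%:R :> R by rewrite ler1n; near: n; exact: nbhs_infty_gt.
have D0 : 0 < (L ^+ 2)^-1 by rewrite invr_gt0.
have [F F0 FE] : exists2 F : R, 0 < F &
    Order.min n%:R%:E (acq_order n (r n)) = F%:E by near: n.
exists F; suff [F' accE FF'] : exists2 F', acq_order n (r n) = F'%:E & F <= F' <= (1 + (L ^+ 2)^-1) * F.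
  by exists F'.
move: FE; rewrite /acq_order; have [rn|rn] := ltP (r n) 1.
  rewrite minxx => -[<-]; exists n%:R => //; rewrite lexx /=.
  by rewrite ler_peMl //; lra.
have {rn} rn : 1 + eps <= r n.
  have [h|//] : r n < 1 \/ 1 + eps <= r n by near: n.
  by rewrite ltNge rn in h.
have Lr : L <= r n * lg (r n).
  have e1 : 1 <= 1 + eps by lra.
  apply: ler_pM => //; rewrite ?ler_lg ?posrE //; try lra.
  by rewrite divr_ge0 ?ln_ge0 // ler1n.
case: ifP => _; last first.
  rewrite min_r ?lee_fin // => -[<-]; exists 1 => //; rewrite lexx /=.
  by rewrite mulr1; lra.
set x := (r n * lg (r n)) ^+ 2.
have Lx : L ^+ 2 <= x by rewrite /x ler_sqr ?nnegrE ?(ltW L0) // (le_trans (ltW L0)).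
have x0 : 0 < x by apply: lt_le_trans Lx.
rewrite inver gt_eqF // -EFinM -EFin_min => -[FE].
exists (n%:R / x) => //; rewrite -FE ge_min lexx orbT /=.
have h : n%:R / x <= (L ^+ 2)^-1 * n%:R.
  by rewrite mulrC ler_wpM2r // lef_pV2 ?posrE.
case: (leP n%:R (n%:R / x)) => _; first by rewrite mulrDl mul1r; lra.
by rewrite ler_peMl ?divr_ge0 ?(ltW x0) //; lra.
Unshelve. all: by end_near.
Qed.
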